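(* Let $s\ge2$ be an integer and let $a$ and $b$ be in $B(H)$. The following hold, for all nonnegative integers $M$ and $N$ in items 2–6: 1. $a\in I_s^\infty$ if and only if $\|a\|_{M,N}<\infty$ for all nonnegative integers $M$ and $N$. 2. $\|a\|_{M+1,N}=\|a\|_{M,N}+\|\delta_{\mathbb P}(a)\|_{M,N}$. 3. $\|a\|_{M,N}\le\|a\|_{M,N+1}$. 4. $\|ab\|_{M,N}\le\|a\|_{M,0}\|b\|_{M,N}\le\|a\|_{M,N}\|b\|_{M,N}$. 5. $\|\delta_{\mathbb P}(a)\|_{M,N}\le\|a\|_{M+1,N}$. 6. $\|a^*\|_{M,N}\le\|a\|_{M+N,N}$. 7. $I_s^\infty$ is a complete topological vector space.
   Context: $\mathbb{Z}_s$ is the compact ring of $s$-adic integers $x=\sum_{j\ge0}x_js^j$, $0\le x_j\le s-1$ (i.e. $\varprojlim\mathbb{Z}/s^n\mathbb{Z}$), and $\mathbb{Z}_s^\times=\{x\in\mathbb{Z}_s: x_0\ne0\}$ (a clopen subset; the elements of $s$-adic norm $1$). $H=\ell^2(\mathbb{Z})$ has canonical basis $\{E_l\}_{l\in\mathbb{Z}}$, and $V$ is the isometry $VE_l=E_{sl}$. Every nonzero $l\in\mathbb{Z}$ is written uniquely as $l=s^ml'$ with $m\ge0$, $s\nmid l'$. For $F\in C_0(\mathbb{Z}_{\ge0}\times\mathbb{Z}_s^\times)$ put $M_FE_{s^ml'}=F(m,l')E_{s^ml'}$, $M_FE_0=0$. RD (rapid decay) means decaying faster than any inverse polynomial in the indices.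 $I_s^\infty\subseteq B(H)$ is the set of norm-convergent sums $a=\sum_{n\ge0}V^nM_{F_n}+\sum_{n<0}M_{F_n}(V^* )^{-n}$ with $F_n\in C_0(\mathbb{Z}_{\ge0}\times\mathbb{Z}_s^\times)$ and $\{\sup_x|F_n(m,x)|\}_{m,n}$ RD in $(m,n)$. $I_s^\infty$ is endowed with the locally convex topology given by the norms $\|\cdot\|_{M,N}$ below. $\mathbb{P}$ is the (unbounded, self-adjoint) diagonal operator $\mathbb{P}E_{s^ml'}=mE_{s^ml'}$, $\mathbb{P}E_0=0$, and $\delta_{\mathbb P}(a)=[\mathbb{P},a]$. For nonnegative integers $M,N$ and $a\in B(H)$, $\|a\|_N=\|a(1+\mathbb{P})^N\|$, where $\|\cdot\|$ is the operator norm on $B(H)$, and $\|a\|_{M,N}=\sum_{j=0}^M\binom Mj\|\delta_{\mathbb P}^j(a)\|_N$; these norms may take the value $+\infty$.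
   Formalization: Item 1 is false for arbitrary a in B(H): the projection onto E_0 has all norms finite but is not in I_s^∞. It is proved as: a∈I_s^∞ iff a lies in the operator-norm closure of I_s^∞ and ‖a‖_{M,N}<∞ for all M,N. *)

(* Defs.v *)
From HB Require Import structures.
From mathcomp Require Import all_boot all_order all_algebra complex.
From mathcomp Require Import ring lra.
From mathcomp Require Import all_classical all_reals all_analysis.

Set Implicit Arguments.
Unset Strict Implicit.
Unset Printing Implicit Defensive.

Import Order.TTheory GRing.Theory Num.Theory.
Import numFieldNormedType.Exports.

Local Open Scope classical_set_scope.
Local Open Scope ring_scope.

Notation normc := ComplexField.Normc.normc.

(* MathComp-Analysis equips abstract numeric fields with their norm topology;
   this makes that topology available on the concrete type R[i]. *)
HB.instance Definition _ (R : realType) := PseudoPointedMetric.copy R[i] R[i]^o.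

Section L2norm.
Variable R : realType.
Implicit Types x y : int -> R[i].

(* The l^2 norm of an arbitrary complex family, +oo if not square summable. *)
Definition l2norm x : \bar R :=
  sqrte (\esum_(k in [set: int]) ((normc (x k) ^+ 2)%:E)).

Definition square_summable x : bool := (l2norm x < +oo)%E.

Lemma normc_ge0 (z : R[i]) : 0 <= normc z.
Proof. by case: z => a b /=; rewrite sqrtr_ge0. Qed.

Lemma normc0 : normc (0 : R[i]) = 0.
Proof. by rewrite /= expr0n addr0 sqrtr0. Qed.

Lemma normcD (z w : R[i]) : normc (z + w) <= normc z + normc w.
Proof. exact: le_normcD. Qed.

Lemma normcN (z : R[i]) : normc (- z) = normc z.
Proof. by case: z => a b /=; rewrite !sqrrN. Qed.

Lemma l2norm_ge0 x : (0 <= l2norm x)%E.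
Proof. exact: sqrte_ge0. Qed.

Lemma esumsq_ge0 x :
  (0 <= \esum_(k in [set: int]) ((normc (x k) ^+ 2)%:E) :> \bar R)%E.
Proof. by apply: esum_ge0 => k _; rewrite lee_fin sqr_ge0. Qed.

Lemma le_l2norm x y : (forall k, normc (x k) <= normc (y k)) ->
  (l2norm x <= l2norm y)%E.
Proof.
move=> xy; rewrite lee_sqrt ?esumsq_ge0//; apply: le_esum => k _.
by rewrite lee_fin ler_sqr ?nnegrE ?normc_ge0.
Qed.

Lemma l2norm0 : l2norm 0 = 0%E.
Proof.
rewrite /l2norm esum1 ?sqrte0// => k _.
by rewrite [X in normc X](_ : _ = 0)// ComplexField.Normc.normc0 expr0n.
Qed.

Lemma l2norm_eq0 x : l2norm x = 0%E -> x = 0.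
Proof.
move=> x0; apply/funext => k; apply: ComplexField.Normc.eq0_normc.
have /eqP : (l2norm x <= 0)%E by rewrite x0.
rewrite -{1}(@sqrte0 R) /l2norm lee_sqrt// => /eqP xk.
apply/eqP; rewrite -sqrf_eq0 eq_le sqr_ge0 andbT -lee_fin.
apply: le_trans xk; apply: esum_ge; exists [set k] => //.
by rewrite fsbig_set1.
Qed.

Lemma esumZ (c : R) (f : int -> \bar R) : 0 <= c -> (forall k, 0 <= f k)%E ->
  (\esum_(k in [set: int]) (c%:E * f k)
     <= c%:E * \esum_(k in [set: int]) f k)%E.
Proof.
move=> c0 f0; apply: ge_ereal_sup => _ [A [fA _] <-].
rewrite -ge0_mule_fsumr//; apply: lee_wpmul2l; rewrite ?lee_fin//.
by apply: ereal_sup_ubound; exists A.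
Qed.

Lemma l2normZ (c : R[i]) x : (l2norm (c *: x) <= (normc c)%:E * l2norm x)%E.
Proof.
rewrite -[X in (X * _)%E]/(normc c)%:E.
have -> : (normc c)%:E = sqrte ((normc c ^+ 2)%:E) :> \bar R.
  by rewrite /= sqrtr_sqr ger0_norm ?normc_ge0.
rewrite -sqrteM ?lee_fin ?sqr_ge0// lee_sqrt; last first.
  by rewrite mule_ge0 ?lee_fin ?sqr_ge0// esumsq_ge0.
apply: le_trans (esumZ _ _); rewrite ?sqr_ge0//; last first.
  by move=> k; rewrite lee_fin sqr_ge0.
apply: le_esum => k _; rewrite -EFinM lee_fin.
by rewrite [X in normc X](_ : _ = c * x k)// ComplexField.Normc.normcM exprMn.
Qed.

Lemma l2normN x : l2norm (- x) = l2norm x.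
Proof.
apply/eqP; rewrite eq_le; apply/andP; split; apply: le_l2norm => k;
  by rewrite -[normc (x k)]normcN.
Qed.

(* Minkowski, from (u + v)^2 <= u^2 / t + v^2 / (1 - t) with 0 < t < 1. *)
Lemma l2normD x y : (l2norm (x + y)%R <= l2norm x + l2norm y)%E.
Proof.
have [->|xoo] := eqVneq (l2norm x) +oo%E.
  by rewrite addye ?leey// gt_eqF// (lt_le_trans _ (l2norm_ge0 y)).
have [->|yoo] := eqVneq (l2norm y) +oo%E.
  by rewrite addey ?leey// gt_eqF// (lt_le_trans _ (l2norm_ge0 x)).
have [/l2norm_eq0->|x0] := eqVneq (l2norm x) 0%E.
  by rewrite l2norm0 !add0r.
have [/l2norm_eq0->|y0] := eqVneq (l2norm y) 0%E.
  by rewrite l2norm0 !addr0.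
have sq z : l2norm z != +oo%E ->
    exists2 r : R, l2norm z = r%:E & 0 <= r /\
      \esum_(k in [set: int]) ((normc (z k) ^+ 2)%:E) = (r ^+ 2)%:E.
  rewrite /l2norm; have := esumsq_ge0 z.
  case: (\esum_(k in [set: int]) _) => [r||]//=; rewrite ?eqxx// lee_fin => r0 _.
  by exists (Num.sqrt r) => //; rewrite sqrtr_ge0 sqr_sqrtr.
have [a ax [a0 sa]] := sq _ xoo; have [b bx [b0 sb]] := sq _ yoo.
have {x0 a0} a0 : 0 < a by rewrite lt_neqAle a0 andbT eq_sym -eqe -ax.
have {y0 b0} b0 : 0 < b by rewrite lt_neqAle b0 andbT eq_sym -eqe -bx.
have ab0 : 0 < a + b by rewrite addr_gt0.
rewrite ax bx -EFinD.
have -> : (a + b)%:E = sqrte (((a + b) ^+ 2)%:E) :> \bar R.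
  by rewrite /= sqrtr_sqr ger0_norm ?ltW.
rewrite lee_sqrt ?lee_fin ?sqr_ge0//.
pose p := (a + b) / a; pose q := (a + b) / b.
have p0 : 0 <= p by rewrite divr_ge0 ?ltW.
have q0 : 0 <= q by rewrite divr_ge0 ?ltW.
have -> : ((a + b) ^+ 2)%:E = (p%:E * (a ^+ 2)%:E + q%:E * (b ^+ 2)%:E :> \bar R)%E.
  rewrite -!EFinM -EFinD; congr EFin; rewrite /p /q expr2 -!mulrA mulrDl.
  rewrite [in RHS]expr2 [in RHS]expr2 !mulKf ?gt_eqF//.
  by rewrite -mulrDl -mulrDr.
rewrite -sa -sb.
have H (z : int -> R[i]) : (forall k, 0 <= (normc (z k) ^+ 2)%:E :> \bar R)%E.
  by move=> k; rewrite lee_fin sqr_ge0.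
apply: le_trans (leeD (esumZ p0 (H x)) (esumZ q0 (H y))).
rewrite -esumD; last 2 first.
- by move=> k _; rewrite mule_ge0.
- by move=> k _; rewrite mule_ge0.
apply: le_esum => k _; rewrite -!EFinM -EFinD lee_fin.
apply: (@le_trans _ _ ((normc (x k) + normc (y k)) ^+ 2)).
  by rewrite ler_sqr ?nnegrE ?addr_ge0 ?normc_ge0// normcD.
set u := normc _; set v := normc _.
rewrite -subr_ge0.
suff -> : p * u ^+ 2 + q * v ^+ 2 - (u + v) ^+ 2 = (b * u - a * v) ^+ 2 / (a * b).
  by rewrite divr_ge0 ?sqr_ge0// mulr_ge0 ?ltW.
rewrite /p /q; field; by rewrite !gt_eqF.
Qed.

End L2norm.

Section Ell2.
Variable R : realType.

Lemma square_summable_closed : subsemimod_closed (@square_summable R).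
Proof.
split; first split.
- by rewrite unfold_in /square_summable l2norm0.
- move=> x y; rewrite !unfold_in /square_summable => xoo yoo.
  by apply: le_lt_trans (l2normD x y) _; rewrite lte_add_pinfty.
- move=> c x; rewrite !unfold_in /square_summable => xoo.
  apply: le_lt_trans (l2normZ c x) _.
  by rewrite lte_mul_pinfty// lee_fin normc_ge0.
Qed.

HB.instance Definition _ := GRing.isSubmodClosed.Build R[i] (int -> R[i])
  (@square_summable R) square_summable_closed.

End Ell2.

Record ell2 (R : realType) := Ell2 {
  coords :> int -> R[i];
  coordsP : square_summable coords }.

HB.instance Definition _ (R : realType) := [isSub for @coords R].
HB.instance Definition _ (R : realType) := [Choice of ell2 R by <:].
HB.instance Definition _ (R : realType) :=
  [SubChoice_isSubLmodule of ell2 R by <:].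

Section Operators.
Variable R : realType.
Local Notation H := (ell2 R).
Implicit Types (D : set H) (T U : H -> int -> R[i]).

(* The norm of a map T defined on the domain D: the sup of |T x| over the
   x in D with |x| <= 1.  The values of T are arbitrary families, so that an
   x in D with T x outside of l^2 makes the norm infinite. *)
Definition opnorm D T : \bar R :=
  ereal_sup [set l2norm (T x) | x in D `&` [set x : H | (l2norm x <= 1)%E]].

Lemma opnorm_le D T (c : \bar R) :
  (forall x : H, D x -> (l2norm x <= 1)%E -> (l2norm (T x) <= c)%E) ->
  (opnorm D T <= c)%E.
Proof. by move=> Tc; apply: ge_ereal_sup => _ [x [Dx x1] <-]; exact: Tc. Qed.

Lemma opnorm_ub D T (x : H) : D x -> (l2norm x <= 1)%E ->
  (l2norm (T x) <= opnorm D T)%E.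
Proof. by move=> Dx x1; apply: ereal_sup_ubound; exists x. Qed.

Lemma opnorm_ge0 D T : D 0 -> (0 <= opnorm D T)%E.
Proof.
move=> D0; apply: le_trans (opnorm_ub T D0 _); first exact: l2norm_ge0.
by rewrite l2norm0.
Qed.

Lemma opnormD D T U : (opnorm D (T + U)%R <= opnorm D T + opnorm D U)%E.
Proof.
apply: opnorm_le => x Dx x1; apply: le_trans (l2normD _ _) _.
by apply: leeD; exact: opnorm_ub.
Qed.

Lemma opnormZ D (c : R[i]) T : D 0 ->
  (opnorm D (c *: T) <= (normc c)%:E * opnorm D T)%E.
Proof.
move=> D0; apply: opnorm_le => x Dx x1; apply: le_trans (l2normZ _ _) _.
by apply: lee_wpmul2l; [rewrite lee_fin normc_ge0|exact: opnorm_ub].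
Qed.

Lemma opnormN D T : opnorm D (- T) = opnorm D T.
Proof.
rewrite /opnorm; congr (ereal_sup _).
by apply/seteqP; split => _ [x Dx <-]; exists x => //;
  [exact: esym (l2normN _)|exact: l2normN].
Qed.

Definition bounded_linear (a : H -> H) : bool :=
  `[< linear a /\ (opnorm setT (fun x => a x) < +oo)%E >].

Lemma bounded_linear_closed : subsemimod_closed bounded_linear.
Proof.
split; first split.
- rewrite unfold_in; apply/asboolP; split; first by move=> c x y; rewrite /= scaler0 addr0.
  apply: (@le_lt_trans _ _ 0%E) => //; apply: opnorm_le => x _ _.
  by rewrite l2norm0.
- move=> a b; rewrite !unfold_in => /asboolP[la na] /asboolP[lb nb]; apply/asboolP; split.
    move=> c x y; rewrite -[LHS]/(a (c *: x + y) + b (c *: x + y)) la lb.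
    by rewrite addrACA -scalerDr.
  apply: le_lt_trans (opnormD _ (fun x => a x) (fun x => b x)) _.
  exact: lte_add_pinfty.
- move=> c a; rewrite !unfold_in => /asboolP[la na]; apply/asboolP; split.
    move=> d x y; rewrite -[LHS]/(c *: a (d *: x + y)) la.
    by rewrite scalerDr !scalerA mulrC.
  apply: le_lt_trans (opnormZ c (fun x => a x) _) _ => //.
  by rewrite lte_mul_pinfty// lee_fin normc_ge0.
Qed.

HB.instance Definition _ := GRing.isSubmodClosed.Build R[i] (H -> H)
  bounded_linear bounded_linear_closed.

End Operators.

Record bop (R : realType) := Bop {
  bop_fun :> ell2 R -> ell2 R;
  bopP : bounded_linear bop_fun }.

HB.instance Definition _ (R : realType) := [isSub for @bop_fun R].
HB.instance Definition _ (R : realType) := [Choice of bop R by <:].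
HB.instance Definition _ (R : realType) :=
  [SubChoice_isSubLmodule of bop R by <:].

Section BoundedOperators.
Variable R : realType.
Local Notation H := (ell2 R).
Implicit Types a b : bop R.

Definition act a : H -> int -> R[i] := fun x => a x.

Lemma actD a b : act (a + b) = act a + act b. Proof. by []. Qed.
Lemma actN a : act (- a) = - act a. Proof. by []. Qed.
Lemma actZ (c : R[i]) a : act (c *: a) = c *: act a. Proof. by []. Qed.

Lemma bop_linear a : linear a.
Proof. by have /asboolP[] := bopP a. Qed.

Lemma bop_bounded a : (opnorm setT (act a) < +oo)%E.
Proof. by have /asboolP[] := bopP a. Qed.

Lemma bop_le a (x : H) : (l2norm (a x) <= opnorm setT (act a) * l2norm x)%E.
Proof.
have a0Z (c : R[i]) y : a (c *: y) = c *: a y.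
  have a0 : a 0 = 0.
    by have := bop_linear a 1 0 0; rewrite !scale1r addr0 => /eqP;
      rewrite -subr_eq subrr eq_sym => /eqP.
  by have := bop_linear a c y 0; rewrite a0 !addr0.
have [x0|x0] := eqVneq (l2norm x) 0%E.
  have -> : x = 0 by apply: val_inj; exact: l2norm_eq0.
  by rewrite -[X in a X](scale0r 0) a0Z scale0r !l2norm0 mule0.
have : (0 <= l2norm x < +oo)%E by rewrite l2norm_ge0; exact: coordsP x.
case Er: (l2norm x) x0 => [r||]//= r0 /andP[r_ge0 roo]; last by rewrite ltxx in roo.
rewrite lee_fin in r_ge0; have {r0 r_ge0} r0 : 0 < r.
  by rewrite lt_neqAle r_ge0 andbT eq_sym -eqe.
have nc (t : R) : 0 < t -> normc (t%:C)%C = t.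
  by move=> t0 /=; rewrite expr0n addr0 sqrtr_sqr gtr0_norm.
have ri0 : 0 < r^-1 by rewrite invr_gt0.
have -> : x = (r%:C)%C *: ((r^-1%:C)%C *: x).
  by rewrite scalerA -rmorphM/= divff ?gt_eqF// scale1r.
rewrite a0Z muleC; apply: le_trans (l2normZ _ _) _; rewrite nc//.
apply: lee_wpmul2l; first by rewrite lee_fin ltW.
apply: (opnorm_ub (act a)) => //; apply: le_trans (l2normZ _ _) _; rewrite nc// Er.
by rewrite -EFinM mulVf// gt_eqF.
Qed.

Lemma bmul_subproof a b : bounded_linear (fun x => a (b x)).
Proof.
apply/asboolP; split; first by move=> c x y; rewrite !bop_linear.
apply: (@le_lt_trans _ _ (opnorm setT (act a) * opnorm setT (act b))%E).
  apply: opnorm_le => x _ x1; apply: le_trans (bop_le a (b x)) _.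
  by apply: lee_wpmul2l; [exact: opnorm_ge0|exact: (opnorm_ub (act b))].
apply: lte_mul_pinfty; [exact: opnorm_ge0| |exact: bop_bounded].
by rewrite ge0_fin_numE; [exact: bop_bounded|exact: opnorm_ge0].
Qed.

Definition bmul a b : bop R := Bop (bmul_subproof a b).

(* <x, y>, linear in x; the series converges absolutely on l^2. *)
Definition inner (x y : H) : R[i] :=
  limn (fun n : nat =>
    \sum_(i < n.*2.+1) x (i%:Z - n%:Z) * ((y (i%:Z - n%:Z))^*)%C).

Definition is_adjoint a b := forall x y : H, inner (a x) y = inner x (b y).

End BoundedOperators.

Section Sadic.
Variable s : nat.

(* l = s ^ m * l' with s not dividing l', for l != 0; sadic_val 0 = 0. *)
Definition sadic_val (l : int) : nat :=
  (\max_(m < `|l|.+1 | s ^ m %| `|l|) m)%N.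

Definition spart (l : int) : int := (l %/ (s ^ sadic_val l)%N%:Z)%Z.

Lemma sadic_val0 : sadic_val 0 = 0%N.
Proof.
rewrite /sadic_val; apply/eqP; rewrite -leqn0; apply/bigmax_leqP => m _.
by rewrite -ltnS ltn_ord.
Qed.

Lemma sadic_val_spartE (l : int) : l = (s ^ sadic_val l)%N%:Z * spart l.
Proof.
rewrite mulrC divzK// /sadic_val dvdzE absz_nat.
rewrite (bigop.bigmax_eq_arg ord0) ?expn0 ?dvd1n//.
by case: arg_maxnP => //; rewrite expn0 dvd1n.
Qed.

Lemma spart_ndvd (l : int) : (1 < s)%N -> l != 0 -> ~~ (s%:Z %| spart l)%Z.
Proof.
move=> s1 l0; apply/negP => /dvdzP[q qE].
have := sadic_val_spartE l; rewrite qE mulrCA -PoszM -expnSr => lE.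
have dvdl : (s ^ (sadic_val l).+1 %| `|l|)%N.
  by rewrite {2}lE abszM absz_nat dvdn_mull.
have lt : ((sadic_val l).+1 < `|l|.+1)%N.
  rewrite ltnS; apply: leq_trans (ltnW (ltn_expl _ s1)) _.
  by apply: dvdn_leq => //; rewrite absz_gt0.
have := @leq_bigmax_cond _ (fun m : 'I_(`|l|.+1) => (s ^ m %| `|l|)%N)
  (fun m => nat_of_ord m) (Ordinal lt) dvdl.
by rewrite -/(sadic_val l) /= ltnn.
Qed.

(* The s-adic integer with digits x_j, 0 <= x_j < s, is represented by its
   digit sequence; the s-adic topology is the product topology. *)
Definition Zs : set {ptws nat -> nat} := [set x | forall j, (x j < s)%N].

Definition Zs_units : set {ptws nat -> nat} := Zs `&` [set x | x 0%N != 0%N].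

(* The embedding of the integers in Zs; divz rounds down, so that this is
   correct for negative l too. *)
Definition digits (l : int) : {ptws nat -> nat} :=
  fun j => absz ((l %/ (s ^ j)%N%:Z)%Z %% s%:Z)%Z.

Lemma digits_Zs (l : int) : (0 < s)%N -> Zs (digits l).
Proof.
move=> s0 j; rewrite /digits -ltz_nat gez0_abs ?modz_ge0//; last first.
  by rewrite eqz_nat -lt0n.
by rewrite ltz_pmod.
Qed.

Lemma digitsE (l : int) (n : nat) : (0 < s)%N ->
  (l = (\sum_(j < n) digits l j * s ^ j)%N%:Z %[mod (s ^ n)%N%:Z])%Z.
Proof.
move=> s0.
suff -> : (\sum_(j < n) digits l j * s ^ j)%N%:Z =
    l - (l %/ (s ^ n)%N%:Z)%Z * (s ^ n)%N%:Z.
  by rewrite -modzDr; rewrite modzDr -modzDmr -mulNr modzMl addr0.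
elim: n => [|n IHn]; first by rewrite big_ord0 expn0 divz1 mulr1 subrr.
rewrite big_ord_recr/= PoszD IHn PoszM /digits gez0_abs; last first.
  by rewrite modz_ge0// eqz_nat -lt0n.
set q := (l %/ (s ^ n)%N%:Z)%Z.
have -> : (l %/ (s ^ n.+1)%N%:Z)%Z = (q %/ s%:Z)%Z.
  by rewrite /q expnSr PoszM divzMA_ge0.
by rewrite {1}(divz_eq q s%:Z) expnSr PoszM mulrDl mulrA opprD addrA subrK -mulrA [s%:Z * _]mulrC mulrA.

Qed.

Lemma digits_units (l : int) : (0 < s)%N -> ~~ (s%:Z %| l)%Z ->
  Zs_units (digits l).
Proof.
move=> s0 sl; split; first exact: digits_Zs.
by rewrite /= /digits expn0 divz1 absz_eq0; apply: contra sl => /eqP/dvdz_mod0P.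
Qed.

End Sadic.

(* C_0(A) for A with the subspace topology; the values of f off A are
   irrelevant. *)
Definition C0 (R : realType) (X : topologicalType) (A : set X) (f : X -> R[i]) :=
  {within A, continuous f} /\
  forall e : R, 0 < e -> exists K : set X,
    [/\ compact K, K `<=` A & forall p, A p -> ~ K p -> normc (f p) < e].

Section Smooth.
Variables (R : realType) (s : nat).
Local Notation H := (ell2 R).
Local Notation X := (nat * {ptws nat -> nat})%type.
Implicit Types (a b : bop R) (T U : H -> int -> R[i]).

Definition basis_vec (l : int) : int -> R[i] := fun k => (k == l)%:R.

(* V E_l = E_(s l), M_f E_(s^m l') = f (m, l') E_(s^m l') with M_f E_0 = 0,
   and P E_(s^m l') = m E_(s^m l'), as operations on arbitrary families. *)
Definition V (x : int -> R[i]) : int -> R[i] :=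
  fun k => if (s%:Z %| k)%Z then x (k %/ s%:Z)%Z else 0.

Definition Vadj (x : int -> R[i]) : int -> R[i] := fun k => x (s%:Z * k).

Definition Mop (f : X -> R[i]) (x : int -> R[i]) : int -> R[i] :=
  fun k => if k == 0 then 0 else f (sadic_val s k, digits s (spart s k)) * x k.

Definition Pop (x : int -> R[i]) : int -> R[i] := fun k => (sadic_val s k)%:R * x k.

Lemma V_basis l : (0 < s)%N -> V (basis_vec l) = basis_vec (s%:Z * l).
Proof.
move=> s0; apply/funext => k; rewrite /V /basis_vec.
have s0' : s%:Z != 0 by rewrite eqz_nat -lt0n.
case: ifPn => [/dvdzP[q ->]|sk]; first by rewrite mulzK// mulrC (inj_eq (mulfI s0')).
by case: eqP sk => // ->; rewrite dvdz_mulr.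
Qed.

Lemma Vadj_basis l : (0 < s)%N -> Vadj (basis_vec (s%:Z * l)) = basis_vec l.
Proof.
move=> s0; apply/funext => k; rewrite /Vadj /basis_vec (inj_eq (mulfI _))//.
by rewrite eqz_nat -lt0n.
Qed.

Lemma Vadj_basis0 l : ~~ (s%:Z %| l)%Z -> Vadj (basis_vec l) = 0.
Proof.
move=> sl; apply/funext => k; rewrite /Vadj /basis_vec.
by case: eqP sl => // <-; rewrite dvdz_mulr.
Qed.

Definition rapid_decay (g : int -> nat -> \bar R) :=
  forall k : nat, exists c : R, forall (n : int) (m : nat),
    ((((1 + m + `|n|) ^ k)%N%:R)%:E * g n m <= c%:E)%E.

Definition supZs (f : X -> R[i]) (m : nat) : \bar R :=
  ereal_sup [set (normc (f (m, x)))%:E | x in Zs_units s].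

Definition psum (F : int -> X -> R[i]) (N : nat) : H -> int -> R[i] :=
  fun x => \sum_(n < N) iter n V (Mop (F n%:Z) x).

Definition nsum (F : int -> X -> R[i]) (N : nat) : H -> int -> R[i] :=
  fun x => \sum_(n < N) Mop (F (- n.+1%:Z)) (iter n.+1 Vadj x).

Definition opcvg (S : nat -> H -> int -> R[i]) a :=
  opnorm setT (act a - S N) @[N --> \oo] --> 0%E.

Definition Isoo_pred a : Prop := exists F : int -> X -> R[i],
  [/\ forall n, C0 ([set: nat] `*` Zs_units s) (F n),
      rapid_decay (fun n m => supZs (F n) m) &
      exists b c : bop R, [/\ opcvg (psum F) b, opcvg (nsum F) c & a = b + c]].

(* I_s, the operator norm closure of I_s^oo.  Finiteness of all the norms
   |a|_{M,N} implies a in I_s^oo only for a in I_s: the projections onto the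
   lines spanned by E_0 and by E_1 have finite norms and are not in I_s^oo. *)
Definition Is_pred a : Prop := forall e : R, 0 < e ->
  exists2 b, Isoo_pred b & (opnorm setT (act (a - b)%R) < e%:E)%E.

(* The finite linear combinations of basis vectors: a core of all powers of
   the diagonal operator P, and invariant under them. *)
Definition finspan : set H :=
  [set x : H | exists n : nat, forall k : int, (n < `|k|)%N -> x k = 0].

(* P on H: the value is only meaningful on the domain of P, that is when
   Pop x is square summable. *)
Definition PH (x : H) : H := insubd 0 (Pop x).

(* [P, T] on finspan, for a possibly unbounded T.  The outer P acts on
   arbitrary families: [P, T] x is not in l^2 when T x is not in the domain of
   P, and then the norm of [P, T] is +oo. *)
Definition delta T : H -> int -> R[i] := fun x => Pop (T x) - T (PH x).

Definition normN (N : nat) T : \bar R :=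
  opnorm finspan (fun x => T (iter N (fun y => y + PH y) x)).

Definition normMN (M N : nat) T : \bar R :=
  (\sum_(j < M.+1) ('C(M, j)%:R)%:E * normN N (iter j delta T))%E.

End Smooth.

Section SmoothTheory.
Variables (R : realType) (s : nat).
Local Notation H := (ell2 R).
Local Notation X := (nat * {ptws nat -> nat})%type.
Implicit Types (a b : bop R) (T U : H -> int -> R[i]).

Lemma finspan0 : finspan (0 : H).
Proof. by exists 0%N. Qed.

Lemma iter_deltaD j T U :
  iter j (delta s) (T + U) = iter j (delta s) T + iter j (delta s) U.
Proof.
elim: j => [//|j IHj]; rewrite !iterS IHj; apply/funext => x; apply/funext => k.
rewrite /delta /Pop.
rewrite [LHS](_ : _ = (sadic_val s k)%:R *
  (iter j (delta s) T x k + iter j (delta s) U x k) -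
  (iter j (delta s) T (PH s x) k + iter j (delta s) U (PH s x) k))//.
by rewrite mulrDr opprD addrACA.
Qed.

Lemma iter_deltaN j T : iter j (delta s) (- T) = - iter j (delta s) T.
Proof.
elim: j => [//|j IHj]; rewrite !iterS IHj; apply/funext => x; apply/funext => k.
rewrite /delta /Pop.
rewrite [LHS](_ : _ = (sadic_val s k)%:R * (- iter j (delta s) T x k) +
  (- - iter j (delta s) T (PH s x) k))//.
by rewrite mulrN -opprD.
Qed.

Lemma PHE (x : H) : finspan x -> PH s x = Pop s x :> (int -> R[i]).
Proof.
move=> [n xn]; rewrite /PH /insubd; case: insubP => [u _ ->//|/negP[]].
rewrite /square_summable; apply: (@le_lt_trans _ _ (l2norm (n%:R *: coords x))).
  apply: le_l2norm => k; rewrite /Pop.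
  rewrite [X in _ <= normc X](_ : _ = n%:R * x k)//.
  have [nk|kn] := ltnP n `|k|%N; first by rewrite xn// !mulr0.
  rewrite !ComplexField.Normc.normcM ler_wpM2r ?normc_ge0//.
  have nR (m : nat) : normc (m%:R : R[i]) = m%:R.
    rewrite -(rmorph_nat (real_complex R)) /= expr0n addr0 sqrtr_sqr.
    by rewrite ger0_norm.
  rewrite !nR ler_nat (leq_trans _ kn)//; apply/bigmax_leqP => i _.
  by rewrite -ltnS ltn_ord.
apply: le_lt_trans (l2normZ _ _) _; rewrite lte_mul_pinfty ?lee_fin ?normc_ge0//.
exact: coordsP.
Qed.

Lemma iter_shift_finspan N (x : H) : finspan x ->
  finspan (iter N (fun y => y + PH s y) x).
Proof.
elim: N => [//|N IHN] /IHN[n xn]; exists n => k nk.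
rewrite iterS; set y := iter N _ x in xn *.
rewrite [LHS](_ : _ = y k + PH s y k)// xn// add0r /PH.
by rewrite /insubd; case: insubP => [u _ ->|_]//; rewrite /Pop xn// mulr0.
Qed.

Lemma normN_ge0 N T : (0 <= normN s N T)%E.
Proof. exact: opnorm_ge0 finspan0. Qed.

Lemma normMN_ge0 M N T : (0 <= normMN s M N T)%E.
Proof. by apply: sume_ge0 => j _; rewrite mule_ge0 ?normN_ge0// lee_fin. Qed.

Lemma normMN0 M N : normMN s M N (0 : H -> int -> R[i]) = 0%E.
Proof.
have D0 j : iter j (delta s) (0 : H -> int -> R[i]) = 0.
  by apply/(addrI (iter j (delta s) 0)); rewrite -iter_deltaD !addr0.
apply: big1 => j _; rewrite D0 [X in (_ * X)%E](_ : _ = 0%E) ?mule0//.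
apply/eqP; rewrite eq_le normN_ge0 andbT; apply: opnorm_le => x _ _.
by rewrite [X in l2norm X](_ : _ = 0)// l2norm0.
Qed.

Lemma normMND M N T U :
  (normMN s M N (T + U)%R <= normMN s M N T + normMN s M N U)%E.
Proof.
rewrite /normMN -big_split/=; apply: lee_sum => j _.
rewrite -ge0_muleDr ?normN_ge0//; apply: lee_wpmul2l; first by rewrite lee_fin.
by rewrite iter_deltaD; apply: le_trans (opnormD _ _ _).
Qed.

Lemma normMNN M N T : normMN s M N (- T) = normMN s M N T.
Proof.
apply: eq_bigr => j _; rewrite iter_deltaN; congr (_ * _)%E.
by rewrite -[RHS]opnormN.
Qed.

Lemma continuous_withinD (Y : topologicalType) (A : set Y) (f g : Y -> R[i]) :
  {within A, continuous f} -> {within A, continuous g} ->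
  {within A, continuous (f \+ g)}.
Proof.
move=> cf cg x; exact: (@cvgD R[i] R[i]^o _ _ _ f g _ _ (cf x) (cg x)).
Qed.

Lemma C0D (Y : topologicalType) (A : set Y) (f g : Y -> R[i]) :
  C0 A f -> C0 A g -> C0 A (f \+ g).
Proof.
move=> [cf f0] [cg g0]; split; first exact: continuous_withinD.
move=> e e0; have e20 : 0 < e / 2 by rewrite divr_gt0.
have [K [cK KA Kf]] := f0 _ e20; have [L [cL LA Lg]] := g0 _ e20.
exists (K `|` L); split; [exact: compactU|by rewrite subUset|].
move=> p Ap nKL; rewrite (splitr e) (le_lt_trans (normcD _ _))// ltrD//.
- by apply: Kf => // Kp; apply: nKL; left.
- by apply: Lg => // Lp; apply: nKL; right.
Qed.

Lemma C0Z (Y : topologicalType) (A : set Y) (c : R[i]) (f : Y -> R[i]) :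
  C0 A f -> C0 A (fun p => c * f p).
Proof.
move=> [cf f0]; split.
  by move=> x; exact: (@cvgM (R[i] : numFieldType) _ _ _ (fun=> c) f c _ (cvg_cst _) (cf x)).
move=> e e0; have c0 : 0 < normc c + 1 by rewrite ltr_wpDl ?normc_ge0.
have [K [cK KA Kf]] := f0 (e / (normc c + 1)) (divr_gt0 e0 c0).
exists K; split => // p Ap /(Kf _ Ap).
rewrite ComplexField.Normc.normcM ltr_pdivlMr// => /(le_lt_trans _); apply.
by rewrite mulrC ler_wpM2l ?normc_ge0// lerDl.
Qed.

Lemma C00 (Y : topologicalType) (A : set Y) : C0 A (fun _ : Y => 0 : R[i]).
Proof.
split; first by move=> x; exact: cvg_cst.
move=> e e0; exists set0; split; [exact: compact0|exact: sub0set|].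
by move=> p _ _; rewrite normc0.
Qed.

Lemma rapid_decayP (F : int -> X -> R[i]) :
  rapid_decay (fun n m => supZs s (F n) m) <->
  forall k : nat, exists2 c : R, 0 <= c & forall n m x, Zs_units s x ->
    ((1 + m + `|n|) ^ k)%N%:R * normc (F n (m, x)) <= c.
Proof.
have w0 k m n : 0 < ((1 + m + n) ^ k)%N%:R :> R by rewrite ltr0n expn_gt0.
split=> rd k; have [c] := rd k.
  move=> cP; exists `|c|; first exact: normr_ge0.
  move=> n m x sx; apply: le_trans (ler_norm c).
  rewrite -lee_fin EFinM; apply: le_trans (cP n m).
  apply: lee_wpmul2l; first by rewrite lee_fin ltW.
  by apply: ereal_sup_ubound; exists x.
move=> c0 cP; exists c => n m; rewrite muleC -lee_pdivlMr//.
apply: ge_ereal_sup => _ [x sx <-].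
by rewrite lee_fin ler_pdivlMr// mulrC cP.
Qed.

Lemma VD (x y : int -> R[i]) (c : R[i]) : V s (c *: x + y) = c *: V s x + V s y.
Proof.
apply/funext => k; rewrite /V [RHS](_ : _ = c * V s x k + V s y k)// /V.
by case: ifP => // _; rewrite mulr0 addr0.
Qed.

Lemma iterVD n (x y : int -> R[i]) (c : R[i]) :
  iter n (V s) (c *: x + y) = c *: iter n (V s) x + iter n (V s) y.
Proof. by elim: n => // n IHn; rewrite !iterS IHn VD. Qed.

Lemma MopD (f g : X -> R[i]) (c : R[i]) (x : int -> R[i]) :
  Mop s (fun p => c * f p + g p) x = c *: Mop s f x + Mop s g x.
Proof.
apply/funext => k; rewrite [RHS](_ : _ = c * Mop s f x k + Mop s g x k)//.
rewrite /Mop; case: ifP => _; first by rewrite mulr0 addr0.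
by rewrite mulrDl mulrA.
Qed.

Lemma psumD (F G : int -> X -> R[i]) (c : R[i]) N :
  psum s (fun n p => c * F n p + G n p) N = c *: psum s F N + psum s G N.
Proof.
apply/funext => x.
rewrite [RHS](_ : _ = c *: psum s F N x + psum s G N x)// /psum.
rewrite scaler_sumr -big_split/=; apply: eq_bigr => n _.
by rewrite MopD iterVD.
Qed.

Lemma nsumD (F G : int -> X -> R[i]) (c : R[i]) N :
  nsum s (fun n p => c * F n p + G n p) N = c *: nsum s F N + nsum s G N.
Proof.
apply/funext => x.
rewrite [RHS](_ : _ = c *: nsum s F N x + nsum s G N x)// /nsum.
rewrite scaler_sumr -big_split/=; apply: eq_bigr => n _.
by rewrite MopD.
Qed.

Lemma opcvgD (S S' : nat -> H -> int -> R[i]) (c : R[i]) a b :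
  opcvg S a -> opcvg S' b -> opcvg (fun N => c *: S N + S' N) (c *: a + b).
Proof.
move=> Sa Sb; rewrite /opcvg.
pose u (N : nat) := ((normc c)%:E * opnorm setT (act a - S N)%R +
                    opnorm setT (act b - S' N)%R)%E.
apply: (@squeeze_cvge _ _ _ _ (fun=> 0%E) _ u).
- apply: nearW => N; rewrite opnorm_ge0//= /u.
  rewrite [X in opnorm _ X](_ : _ = c *: (act a - S N) + (act b - S' N)).
    by apply: le_trans (opnormD _ _ _) _; apply: leeD => //; exact: opnormZ.
  by rewrite actD actZ scalerBr opprD addrACA.
- exact: cvg_cst.
- rewrite (_ : 0%E = (normc c)%:E * 0 + 0)%E; last by rewrite mule0 adde0.
  by apply: cvgeD => //; apply: cvgeZl.
Qed.

Lemma Isoo_pred_lin (c : R[i]) a b :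
  Isoo_pred s a -> Isoo_pred s b -> Isoo_pred s (c *: a + b).
Proof.
move=> [F [F0 /rapid_decayP Frd [a1 [a2 [Fa1 Fa2 aE]]]]].
move=> [G [G0 /rapid_decayP Grd [b1 [b2 [Gb1 Gb2 bE]]]]].
exists (fun n p => c * F n p + G n p); split.
- by move=> n; apply: C0D (C0Z c (F0 n)) (G0 n).
- apply/rapid_decayP => k; have [d d0 Fd] := Frd k; have [e e0 Ge] := Grd k.
  exists (normc c * d + e); first by rewrite addr_ge0 ?mulr_ge0 ?normc_ge0.
  move=> n m x sx; set w := (_%:R : R).
  apply: (@le_trans _ _ (w * (normc c * normc (F n (m, x)) + normc (G n (m, x))))).
    rewrite ler_wpM2l ?ler0n// (le_trans (normcD _ _))//.
    by rewrite ComplexField.Normc.normcM.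
  rewrite mulrDr mulrCA lerD// ?Ge//.
  by rewrite ler_wpM2l ?normc_ge0// Fd.
- exists (c *: a1 + b1), (c *: a2 + b2); split.
  + rewrite (_ : psum _ _ = fun N => c *: psum s F N + psum s G N).
      exact: opcvgD.
    by apply/funext => N; rewrite psumD.
  + rewrite (_ : nsum _ _ = fun N => c *: nsum s F N + nsum s G N).
      exact: opcvgD.
    by apply/funext => N; rewrite nsumD.
  + by rewrite aE bE scalerDr addrACA.
Qed.

Lemma Isoo_pred0 : Isoo_pred s (0 : bop R).
Proof.
have M0 (x : int -> R[i]) : Mop s (fun=> 0) x = 0.
  by apply/funext => k; rewrite /Mop; case: ifP => // _; rewrite mul0r.
have V0 n : iter n (V s) (0 : int -> R[i]) = 0.
  elim: n => // n IHn; rewrite iterS IHn; apply/funext => k.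
  by rewrite /V; case: ifP.
have c0 (S : nat -> H -> int -> R[i]) : (forall N x, S N x = 0) -> opcvg S 0.
  move=> S0; rewrite /opcvg (_ : (fun N => _) = fun=> 0%E); first exact: cvg_cst.
  apply/funext => N; apply/eqP; rewrite eq_le opnorm_ge0// andbT.
  apply: opnorm_le => x _ _; rewrite [X in l2norm X](_ : _ = 0) ?l2norm0//.
  by rewrite -[LHS]/(0 - S N x) S0 subr0.
exists (fun _ _ => 0); split.
- by move=> n; exact: C00.
- apply/rapid_decayP => k; exists 0 => // n m x _.
  by rewrite normc0 mulr0.
- exists 0, 0; split; last by rewrite addr0.
  + by apply: c0 => N x; apply: big1 => n _; rewrite M0 V0.
  + by apply: c0 => N x; apply: big1 => n _; rewrite M0.
Qed.

Definition Isoo_bool a : bool := `[< Isoo_pred s a >].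

Lemma Isoo_closed : subsemimod_closed Isoo_bool.
Proof.
split; first split.
- by rewrite unfold_in; apply/asboolP; exact: Isoo_pred0.
- move=> a b; rewrite !unfold_in => /asboolP aI /asboolP bI; apply/asboolP.
  by rewrite -[a]scale1r; exact: Isoo_pred_lin.
- move=> c a; rewrite !unfold_in => /asboolP aI; apply/asboolP.
  by rewrite -[_ *: _]addr0; apply: Isoo_pred_lin => //; exact: Isoo_pred0.
Qed.

HB.instance Definition _ := GRing.isSubmodClosed.Build R[i] (bop R)
  Isoo_bool Isoo_closed.

End SmoothTheory.

Record Isoo (R : realType) (s : nat) := IsooOf {
  isoo_bop :> bop R;
  isooP : Isoo_bool s isoo_bop }.

HB.instance Definition _ (R : realType) (s : nat) := [isSub for @isoo_bop R s].
HB.instance Definition _ (R : realType) (s : nat) := [Choice of Isoo R s by <:].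
HB.instance Definition _ (R : realType) (s : nat) :=
  [SubChoice_isSubLmodule of Isoo R s by <:].

Section IsooUniform.
Variables (R : realType) (s : nat).
Local Notation E := (Isoo R s).

(* The uniformity given by all the norms |.|_{M,N}: a base is made of the sets
   |a - b|_{M,N} < e for all M, N <= n. *)
Definition isoo_base (ne : nat * R) : set (E * E) :=
  [set ab : E * E | forall M N : nat, (M <= ne.1)%N -> (N <= ne.1)%N ->
     (normMN s M N (act (isoo_bop ab.1 - isoo_bop ab.2)%R) < ne.2%:E)%E].

Definition isoo_ent : set_system (E * E) :=
  filter_from [set ne : nat * R | 0 < ne.2] isoo_base.

Local Open Scope relation_scope.

Lemma isoo_ent_filter : Filter isoo_ent.
Proof.
apply: filter_from_filter; first by exists (0%N, 1) => /=.
move=> [n e] [m d] /= e0 d0; exists (maxn n m, Num.min e d) => /=.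
  by rewrite lt_min e0.
move=> ab H; split => M N /= Mn Nn; apply: lt_le_trans (H M N _ _) _ => /=;
  by rewrite ?leq_max ?Mn ?Nn ?orbT// lee_fin ge_min lexx ?orbT.
Qed.

Lemma isoo_ent_refl A : isoo_ent A -> diagonal `<=` A.
Proof.
move=> [[n e] /= e0 eA] [a b] /diagonalP ->; apply: eA => M N _ _ /=.
by rewrite subrr normMN0 lte_fin.
Qed.

Lemma isoo_ent_inv A : isoo_ent A -> isoo_ent A^-1.
Proof.
move=> [ne e0 eA]; exists ne => // -[a b] H; apply: eA => M N Mn Nn /=.
by rewrite -opprB actN normMNN; exact: H.
Qed.

Lemma isoo_ent_split A : isoo_ent A -> exists2 B, isoo_ent B & B \; B `<=` A.
Proof.
move=> [[n e] /= e0 eA]; exists (isoo_base (n, e / 2)).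
  by exists (n, e / 2) => //=; rewrite divr_gt0.
move=> [a b] [c /= H1 H2]; apply: eA => M N /= Mn Nn.
rewrite (_ : _ - _ = (isoo_bop a - isoo_bop c) + (isoo_bop c - isoo_bop b));
  last by rewrite addrA subrK.
rewrite actD; apply: le_lt_trans (normMND _ _ _ _ _) _.
rewrite [e in (_ < e%:E)%E]splitr EFinD; apply: lteD.
  exact: H1.
exact: H2.
Qed.

HB.instance Definition _ := isUniform.Build E
  isoo_ent_filter isoo_ent_refl isoo_ent_inv isoo_ent_split.

End IsooUniform.

(* Main.v *)
(* An operator on l^2(Z) is studied through its matrix a_kl.  Writing v(l) for
   the exponent of s in l, delta_P^j (a) (1 + P)^N has the matrix
   (v(k) - v(l))^j a_kl (1 + v(l))^N, and the norm of a matrix, taken over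
   finitely supported vectors, is lower semicontinuous under entrywise
   convergence and invariant under adjunction.  So items 4 and 6 reduce to
   binomial identities between entries: the Leibniz rule for a Q_n b, where Q_n
   is the projection onto the E_l with |l| <= n, and the expansion of
   (1 + v(k))^N = ((1 + v(l)) + (v(k) - v(l)))^N.

   The matrix of an element of I_s^oo vanishes unless k and l are nonzero and
   k / l = s^n for some integer n, in which case it is F_n(min(v(k), v(l)), l'),
   l' being their common part not divisible by s.  Each row and each column contains at
   most one entry on the diagonal k / l = s^n, so Schur's test bounds the
   operator norm by a sum over n and rapid decay makes all norms finite.
   Conversely a in I_s is a norm limit of elements of I_s^oo; their functions
   F_n are uniformly Cauchy because the integers not divisible by s are dense
   in Z_s^x, and the finite norms of a bound the entries of a, i.e. the limits
   of the F_n, rapidly in (m, n).  Completeness follows: the operator norm limit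
   of a Cauchy sequence is in I_s and has finite norms. *)
Require Import Defs.
From mathcomp Require Import all_boot all_order all_algebra complex.
From mathcomp Require Import zify ring lra.
From mathcomp Require Import all_classical all_reals all_analysis.

Set Implicit Arguments.
Unset Strict Implicit.
Unset Printing Implicit Defensive.

Import Order.TTheory GRing.Theory Num.Theory.
Import numFieldNormedType.Exports.

Local Open Scope classical_set_scope.
Local Open Scope ring_scope.

(** * Complex sequences *)

Section ComplexModulus.
Variable R : realType.
Implicit Types (z w : R[i]) (u v : nat -> R[i]).

Definition normcM z w : normc (z * w) = normc z * normc w :=
  ComplexField.Normc.normcM z w.

Lemma normc_nat n : normc (n%:R : R[i]) = n%:R.
Proof.
rewrite -(rmorph_nat (real_complex R)) /= expr0n addr0 sqrtr_sqr.
by rewrite ger0_norm.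
Qed.

Lemma normc1 : normc (1 : R[i]) = 1. Proof. exact: (normc_nat 1). Qed.

Lemma normcX z n : normc (z ^+ n) = normc z ^+ n.
Proof. by elim: n => [|n IHn]; rewrite ?expr0 ?normc1// !exprS normcM IHn. Qed.

Lemma normcJ z : normc (z^*)%C = normc z.
Proof. by case: z => x y /=; rewrite sqrrN. Qed.

Lemma normcB z w : normc (z - w) = normc (w - z).
Proof. by rewrite -normcN opprB. Qed.

Lemma mulcJ_normc z : z * (z^*)%C = ((normc z ^+ 2)%:C)%C.
Proof.
case: z => x y /=; rewrite sqr_sqrtr ?addr_ge0 ?sqr_ge0//; apply/eqP.
by rewrite eq_complex /=; apply/andP; split; apply/eqP; ring.
Qed.

Lemma normc_sum (I : Type) (r : seq I) (P : pred I) (f : I -> R[i]) :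
  normc (\sum_(i <- r | P i) f i) <= \sum_(i <- r | P i) normc (f i).
Proof.
elim/big_rec2: _ => [|i x y _ xy]; first by rewrite normc0.
by apply: le_trans (normcD _ _) _; rewrite lerD2l.
Qed.

Lemma normc_dist z w : `|normc z - normc w| <= normc (z - w).
Proof.
rewrite ler_norml; apply/andP; split.
  by have := normcD (w - z) z; rewrite subrK normcB; lra.
by have := normcD (z - w) w; rewrite subrK; lra.
Qed.

Lemma normc_ReIm z : normc z <= `|complex.Re z| + `|complex.Im z|.
Proof.
case: z => x y /=; rewrite -ler_sqr ?nnegrE ?sqrtr_ge0 ?addr_ge0//.
rewrite sqr_sqrtr ?addr_ge0 ?sqr_ge0// -[x ^+ 2]real_normK ?num_real//.
rewrite -[y ^+ 2]real_normK ?num_real//.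
have := normr_ge0 x; have := normr_ge0 y; nra.
Qed.

Lemma Re_le_normc z : `|complex.Re z| <= normc z.
Proof.
case: z => x y /=; rewrite -ler_sqr ?nnegrE ?sqrtr_ge0//.
by rewrite sqr_sqrtr ?addr_ge0 ?sqr_ge0// real_normK ?num_real// lerDl sqr_ge0.
Qed.

Lemma Im_le_normc z : `|complex.Im z| <= normc z.
Proof.
case: z => x y /=; rewrite -ler_sqr ?nnegrE ?sqrtr_ge0//.
by rewrite sqr_sqrtr ?addr_ge0 ?sqr_ge0// real_normK ?num_real// lerDr sqr_ge0.
Qed.

(** Convergence in [R[i]] is stated through the real modulus, so that squeezing and the limit rules
    for real sequences apply. *)
Definition ccvg u z := normc (u n - z) @[n --> \oo] --> (0 : R).

Lemma ccvgP u z : ccvg u z <->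
  forall e : R, 0 < e -> exists N, forall n, (N <= n)%N -> normc (u n - z) < e.
Proof.
split=> [/cvgrPdist_lt cu e /cu[N _ Nu]|cu].
  by exists N => n /Nu /=; rewrite sub0r normrN ger0_norm ?normc_ge0.
apply/cvgrPdist_lt => e /cu[N Nu]; exists N => // n /Nu /=.
by rewrite sub0r normrN ger0_norm ?normc_ge0.
Qed.

Lemma ccvg_near u z N : (forall n, (N <= n)%N -> u n = z) -> ccvg u z.
Proof.
by move=> uz; apply/ccvgP => e e0; exists N => n /uz ->; rewrite subrr normc0.
Qed.

Lemma ccvg_le u z (e : nat -> R) : (forall n, normc (u n - z) <= e n) ->
  e n @[n --> \oo] --> (0 : R) -> ccvg u z.
Proof.
move=> ue e0; apply: (@squeeze_cvgr _ _ _ _ (fun=> 0) e) => //.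
  by apply: nearW => n; rewrite normc_ge0 ue.
exact: cvg_cst.
Qed.

Lemma ccvgD u v z w : ccvg u z -> ccvg v w -> ccvg (fun n => u n + v n) (z + w).
Proof.
move=> uz vw; apply: (@ccvg_le _ _ (fun n => normc (u n - z) + normc (v n - w))).
  by move=> n; rewrite opprD addrACA normcD.
by rewrite -[0]addr0; exact: cvgD.
Qed.

Lemma ccvgM z u w : ccvg u w -> ccvg (fun n => z * u n) (z * w).
Proof.
move=> uw; apply: (@ccvg_le _ _ (fun n => normc z * normc (u n - w))).
  by move=> n; rewrite -mulrBr normcM.
by rewrite -[0](mulr0 (normc z)); apply: cvgM => //; exact: cvg_cst.
Qed.

Lemma ccvg_sum (I : Type) (r : seq I) (f : I -> nat -> R[i]) (g : I -> R[i]) :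
  (forall i, ccvg (f i) (g i)) ->
  ccvg (fun n => \sum_(i <- r) f i n) (\sum_(i <- r) g i).
Proof.
move=> fg; elim: r => [|i r IHr].
  by apply: (ccvg_near (N := 0)) => n _; rewrite !big_nil.
by under eq_fun do rewrite big_cons; rewrite big_cons; exact: ccvgD.
Qed.

Lemma ccvg_uniq u z w : ccvg u z -> ccvg u w -> z = w.
Proof.
move=> uz uw; have : ccvg (fun=> 0) (z - w).
  apply: (@ccvg_le _ _ (fun n => normc (u n - w) + normc (u n - z))).
    move=> n; rewrite sub0r normcN -(normcN (u n - z)).
    by have := normcD (u n - w) (- (u n - z)); rewrite opprB addrC addrA subrK.
  by rewrite -[0]addr0; exact: cvgD.
move=> /ccvgP zw; apply/eqP; rewrite -subr_eq0; apply/eqP.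
apply: ComplexField.Normc.eq0_normc; apply/eqP; rewrite eq_le normc_ge0 andbT.
apply/ler_addgt0Pl => e /zw[N /(_ _ (leqnn N))]; rewrite sub0r normcN addr0.
exact: ltW.
Qed.

Lemma ccvg_normc u z : ccvg u z -> normc (u n) @[n --> \oo] --> normc z.
Proof.
move=> /ccvgP uz; apply/cvgrPdist_lt => e /uz[N Nu]; exists N => // n /Nu /=.
by apply: le_lt_trans; rewrite distrC normc_dist.
Qed.

Lemma ccvg_normc_le u z c N : ccvg u z -> (forall n, (N <= n)%N -> normc (u n) <= c) ->
  normc z <= c.
Proof.
move=> /ccvg_normc uz uc; rewrite -(cvg_lim _ uz)//; apply: limr_le.
  by apply/cvg_ex; exists (normc z).
by exists N => // n /= /uc.
Qed.

(** Real and imaginary parts respect differences and are bounded by the modulus, so each is a real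
    Cauchy sequence; [rc] treats both at once. *)
Lemma ccvg_cauchy u (e : nat -> R) : e n @[n --> \oo] --> (0 : R) ->
  (forall n m, (n <= m)%N -> normc (u m - u n) <= e n) ->
  exists z, ccvg u z.
Proof.
move=> e0 ue.
have rc (f : R[i] -> R) : (forall z w, f (z - w) = f z - f w) ->
    (forall z, `|f z| <= normc z) ->
    exists l : R, f (u n) @[n --> \oo] --> l.
  move=> fB fle; exists (limn (f \o u)).
  suff : cvgn (f \o u) by [].
  apply/cauchy_cvgP/cauchy_exP => d d0.
  have /cvgrPdist_lt/(_ _ d0)[N _ Nd] := e0.
  exists (f (u N)); exists N => // n /= Nn; rewrite /ball/= -fB.
  apply: le_lt_trans (fle _) _; rewrite normcB; apply: le_lt_trans (ue _ _ Nn) _.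
  have := Nd N (leqnn N); rewrite /= sub0r normrN; apply: le_lt_trans.
  exact: ler_norm.
have [x xu] : exists l : R, complex.Re (u n) @[n --> \oo] --> l.
  by apply: rc Re_le_normc => -[? ?] [? ?].
have [y yu] : exists l : R, complex.Im (u n) @[n --> \oo] --> l.
  by apply: rc Im_le_normc => -[? ?] [? ?].
exists (x +i* y)%C.
apply: (@ccvg_le _ _ (fun n => `|x - complex.Re (u n)| + `|y - complex.Im (u n)|)).
  move=> n; rewrite [`|x - _|]distrC [`|y - _|]distrC.
  by apply: le_trans (normc_ReIm _) _; case: (u n).
have d0 (a : R) (v : nat -> R) : v n @[n --> \oo] --> a -> `|a - v n| @[n --> \oo] --> (0 : R).
  move=> va; rewrite -(normr0 R) -(subrr a).
  by apply: cvg_norm; apply: cvgB => //; exact: cvg_cst.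
by rewrite -[0]addr0; apply: cvgD; exact: d0.
Qed.

End ComplexModulus.

(** * The space l^2(Z) *)

(** The window from -n to n, listed in the order of the partial sums in [inner]. *)
Definition zr (n : nat) : seq int := [seq i%:Z - n%:Z | i <- iota 0 n.*2.+1].

Lemma mem_zr n k : (k \in zr n) = (`|k| <= n)%N.
Proof.
apply/mapP/idP => [[j jn ->]|kn]; first by move: jn; rewrite mem_iota; lia.
by exists (absz (k + n%:Z)); [rewrite mem_iota; lia|lia].
Qed.

Lemma zr_uniq n : uniq (zr n).
Proof. by rewrite map_inj_uniq ?iota_uniq// => i j; lia. Qed.

Lemma big_zr_widen (V : nmodType) n m (f : int -> V) : (n <= m)%N ->
  \sum_(k <- zr n) f k = \sum_(k <- zr m | (`|k| <= n)%N) f k.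
Proof.
move=> nm; rewrite -[RHS]big_filter; apply: perm_big; apply: uniq_perm.
- exact: zr_uniq.
- by rewrite filter_uniq// zr_uniq.
- move=> k; rewrite mem_filter !mem_zr; case: leqP => //= kn.
  by rewrite (leq_trans kn).
Qed.

Lemma big_zr_pick (V : nmodType) n (f : int -> V) l :
  (forall k, k != l -> f k = 0) ->
  \sum_(k <- zr n) f k = if (`|l| <= n)%N then f l else 0.
Proof.
move=> f0; case: ifPn => [ln|nl].
  rewrite (bigD1_seq l) ?mem_zr ?zr_uniq//= big1 ?addr0//.
rewrite big_seq big1// => k; rewrite mem_zr => kn; apply: f0.
by apply: contraNneq nl => <-.
Qed.

(** Lagrange's identity: the double sum of [(a i * b j - a j * b i) ^+ 2] is twice the difference of
    the two sides. *)
Lemma sum_CS (R : realType) (I : Type) (r : seq I) (a b : I -> R) :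
  (\sum_(i <- r) a i * b i) ^+ 2 <=
    (\sum_(i <- r) a i ^+ 2) * (\sum_(i <- r) b i ^+ 2).
Proof.
have : 0 <= \sum_(i <- r) \sum_(j <- r) (a i * b j - a j * b i) ^+ 2.
  by apply: sumr_ge0 => i _; apply: sumr_ge0 => j _; rewrite sqr_ge0.
have -> : \sum_(i <- r) \sum_(j <- r) (a i * b j - a j * b i) ^+ 2 =
    \sum_(i <- r) \sum_(j <- r) (a i ^+ 2 * b j ^+ 2 +
      (b i ^+ 2 * a j ^+ 2 - 2 * ((a i * b i) * (a j * b j)))).
  by apply: eq_bigr => i _; apply: eq_bigr => j _; ring.
under eq_bigr do rewrite big_split sumrB -!mulr_sumr/=.
rewrite big_split sumrB/= -!mulr_suml -mulr_sumr -mulr_suml.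
by rewrite expr2; lra.
Qed.

Section L2.
Variable R : realType.
Local Notation H := (ell2 R).
Implicit Types (x : H) (y z : int -> R[i]) (T U : H -> int -> R[i]).

(** The sum over Z is a supremum over finite sets, and every finite set of integers lies in a
    window. Bounds on [l2norm] thus become bounds on finite real sums. *)
Lemma l2norm_leP y (c : R) : 0 <= c -> (l2norm y <= c%:E)%E <->
  forall n, \sum_(k <- zr n) normc (y k) ^+ 2 <= c ^+ 2.
Proof.
move=> c0; have -> : c%:E = sqrte ((c ^+ 2)%:E) :> \bar R.
  by rewrite /= sqrtr_sqr ger0_norm.
have f0 k : (0 <= (normc (y k) ^+ 2)%:E :> \bar R)%E by rewrite lee_fin sqr_ge0.
rewrite lee_sqrt ?lee_fin ?sqr_ge0//; split=> [yc n|yc].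
  rewrite -lee_fin; apply: le_trans yc; apply: esum_ge.
  exists [set` zr n]; first by split => //; exact: finite_seq.
  by rewrite -fsbig_seq ?zr_uniq// sumEFin.
apply: ge_ereal_sup => _ [A [fA _] <-].
have [r rE] : exists r : seq int, A = [set` r] by apply/finite_seqP.
pose n := (\max_(k <- r) `|k|)%N.
apply: (@le_trans _ _ (\sum_(k \in [set` zr n]) (normc (y k) ^+ 2)%:E)%E).
  apply: lee_fsum_nneg_subset => //; first exact: finite_seq.
  move=> k; rewrite rE !inE/= => kr; rewrite mem_zr.
  exact: (@leq_bigmax_seq _ r xpredT (fun k : int => `|k|%N)).
by rewrite -fsbig_seq ?zr_uniq// sumEFin lee_fin.
Qed.

Lemma ell2_fin x : l2norm x \is a fin_num.
Proof. by rewrite ge0_fin_numE ?l2norm_ge0//; exact: coordsP. Qed.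

Lemma normc_le_l2norm y k : ((normc (y k))%:E <= l2norm y)%E.
Proof.
case E : (l2norm y) => [c||]; last 2 first.
- by rewrite leey.
- by have := l2norm_ge0 y; rewrite E.
have c0 : 0 <= c by rewrite -lee_fin -E l2norm_ge0.
have /(l2norm_leP _ c0)/(_ `|k|%N) : (l2norm y <= c%:E)%E by rewrite E.
rewrite lee_fin -[normc _ <= c]ler_sqr ?nnegrE ?normc_ge0//; apply: le_trans.
by rewrite (bigD1_seq k) ?mem_zr ?zr_uniq//= lerDl sumr_ge0// => i _; rewrite sqr_ge0.
Qed.

(** Fatou's lemma for l^2: a window sum has finitely many terms, so its bound passes to the
    limit. *)
Lemma l2norm_lim (u : nat -> int -> R[i]) y (c : \bar R) N :
  (forall k, ccvg (u^~ k) (y k)) -> (forall n, (N <= n)%N -> (l2norm (u n) <= c)%E) ->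
  (l2norm y <= c)%E.
Proof.
case: c => [c||] uy uc; rewrite ?leey//; last first.
  by have := uc N (leqnn N); rewrite leeNy_eq; have := l2norm_ge0 (u N); case: l2norm.
have c0 : 0 <= c by rewrite -lee_fin (le_trans _ (uc _ (leqnn N)))// l2norm_ge0.
apply/l2norm_leP => // n.
have S : \sum_(k <- zr n) normc (u m k) ^+ 2 @[m --> \oo] -->
    \sum_(k <- zr n) normc (y k) ^+ 2.
  elim: (zr n) => [|k r IHr].
    by under eq_fun do rewrite big_nil; rewrite big_nil; exact: cvg_cst.
  under eq_fun do rewrite big_cons; rewrite big_cons; apply: cvgD => //.
  under eq_fun do rewrite expr2; rewrite expr2.
  by apply: cvgM; exact: ccvg_normc.
rewrite -(cvg_lim _ S)//; apply: limr_le; first by apply/cvg_ex; eexists; exact: S.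
by exists N => // m /= /uc /(l2norm_leP _ c0).
Qed.

Definition cut n y : int -> R[i] := fun k => if (`|k| <= n)%N then y k else 0.

Lemma cut_summable n y : square_summable (cut n y).
Proof.
(* Since [c] is at least 1, the window sum is at most [c <= c ^+ 2], the form that [l2norm_leP]
   expects. *)
pose c := 1 + \sum_(k <- zr n) normc (y k) ^+ 2.
have S0 : 0 <= \sum_(k <- zr n) normc (y k) ^+ 2.
  by apply: sumr_ge0 => k _; rewrite sqr_ge0.
have c1 : 1 <= c by rewrite lerDl.
apply: (@le_lt_trans _ _ c%:E); last by rewrite ltry.
apply/l2norm_leP => [|m]; first exact: le_trans c1.
apply: (@le_trans _ _ c); last by rewrite expr2; nra.
have cutE k : normc (cut n y k) ^+ 2 = if (`|k| <= n)%N then normc (y k) ^+ 2 else 0.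
  by rewrite /cut; case: ifP; rewrite // normc0 expr0n.
under eq_bigr do rewrite cutE; rewrite -big_mkcond/=.
apply: le_trans (_ : \sum_(k <- zr n) normc (y k) ^+ 2 <= _); last by rewrite lerDr.
rewrite (big_zr_widen _ (leq_maxr m n)) [leRHS]big_mkcond/=.
rewrite -big_mkcondr/=.
rewrite [leLHS](_ : _ =
    \sum_(k <- zr (maxn m n) | (`|k| <= m)%N && (`|k| <= n)%N) normc (y k) ^+ 2).
  rewrite [leRHS](bigID (fun k : int => (`|k| <= m)%N))/=.
  rewrite [X in X + _](_ : _ =
      \sum_(k <- zr (maxn m n) | (`|k| <= m)%N && (`|k| <= n)%N) normc (y k) ^+ 2).
    by rewrite lerDl sumr_ge0// => k _; rewrite sqr_ge0.
  by apply: eq_bigl => k; rewrite andbC.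
by rewrite big_mkcond (big_zr_widen _ (leq_maxl m n)) -big_mkcondr.
Qed.

Definition trunc n y : H := Ell2 (cut_summable n y).

Lemma truncE n y k : trunc n y k = if (`|k| <= n)%N then y k else 0.
Proof. by []. Qed.

Lemma finspan_trunc n y : finspan (trunc n y).
Proof. by exists n => k; rewrite truncE ltnNge => /negbTE ->. Qed.

Lemma le_trunc n y : (l2norm (trunc n y) <= l2norm y)%E.
Proof.
apply: le_l2norm => k; rewrite truncE; case: ifP => // _.
by rewrite normc0 normc_ge0.
Qed.

Lemma trunc_id n x : (forall k, (n < `|k|)%N -> x k = 0) -> trunc n x = x.
Proof.
move=> xn; apply: val_inj; apply/funext => k; rewrite /= /cut.
by case: leqP => // /xn.
Qed.

Lemma trunc_cvg x (e : R) : 0 < e -> exists N, forall n, (N <= n)%N ->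
  (l2norm (coords x - trunc n x)%R <= e%:E)%E.
Proof.
move=> e0; have := ell2_fin x; have := l2norm_ge0 x.
case E : (l2norm x) => [c||]// c0 _; rewrite lee_fin in c0.
pose S n := \sum_(k <- zr n) normc (x k) ^+ 2.
have [N SN] : exists N, c ^+ 2 - e ^+ 2 <= S N.
  (* If every window sum stayed below [c ^+ 2 - e ^+ 2], the norm would be at most the root of this
     number, which is less than [c]. *)
  apply: contrapT => /forallNP ub;
  have lt N : S N < c ^+ 2 - e ^+ 2 by rewrite ltNge; apply/negP/ub.
  have d0 : 0 < c ^+ 2 - e ^+ 2.
    by apply: le_lt_trans (lt 0%N); apply: sumr_ge0 => k _; rewrite sqr_ge0.
  have : (l2norm x <= (Num.sqrt (c ^+ 2 - e ^+ 2))%:E)%E.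
    apply/(l2norm_leP _ (sqrtr_ge0 _)) => n.
    by rewrite sqr_sqrtr; [exact: ltW (lt n)|exact: ltW].
  rewrite E lee_fin -ler_sqr ?nnegrE ?sqrtr_ge0// sqr_sqrtr ?(ltW d0)//.
  by have := exprn_gt0 2 e0; move: (c ^+ 2) (e ^+ 2) => u v h1 h2; lra.
have Sc n : S n <= c ^+ 2.
  by have /(l2norm_leP _ c0)/(_ n) : (l2norm x <= c%:E)%E by rewrite E.
exists N => n Nn; apply/l2norm_leP => [|m]; first exact: ltW.
pose p := maxn m n.
have split_p : S p = S N + \sum_(k <- zr p | ~~ (`|k| <= N)%N) normc (x k) ^+ 2.
  rewrite /S (bigID (fun k : int => (`|k| <= N)%N))/= -big_zr_widen//.
  by rewrite (leq_trans Nn)// leq_maxr.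
apply: (@le_trans _ _ (\sum_(k <- zr p | ~~ (`|k| <= N)%N) normc (x k) ^+ 2)); last first.
  by have := Sc p; rewrite split_p => h1; move: SN => h2; lra.
rewrite (big_zr_widen _ (leq_maxl m n)) big_mkcond [leRHS]big_mkcond/=.
apply: ler_sum => k _; rewrite -[X in normc X]/(x k - trunc n x k) truncE.
case: (leqP `|k| N) => kN /=; last first.
  case: ifP => _; rewrite ?sqr_ge0//.
  by case: ifP => _; rewrite ?subr0// subrr normc0 expr0n sqr_ge0.
by rewrite (leq_trans kN Nn) subrr normc0 expr0n /= if_same.
Qed.

Definition homog T := forall (c : R[i]) x, T (c *: x) = c *: T x.

Lemma opnorm_bound (D : set H) T (c : R) x : 0 <= c -> homog T ->
  (forall (d : R[i]) x', D x' -> D (d *: x')) ->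
  (opnorm D T <= c%:E)%E -> D x -> (l2norm (T x) <= c%:E * l2norm x)%E.
Proof.
move=> c0 hT DZ Tc Dx.
have := ell2_fin x; have := l2norm_ge0 x.
case E : (l2norm x) => [r||]// r0 _; rewrite lee_fin in r0.
have [r00|rn0] := eqVneq r 0.
  have -> : x = 0 by apply: val_inj; apply: l2norm_eq0; rewrite E r00.
  by rewrite -[X in T X](scale0r 0) hT scale0r l2norm0 -EFinM lee_fin mulr_ge0.
have {r0 rn0} r0 : 0 < r by rewrite lt_neqAle eq_sym rn0.
have nc (t : R) : 0 < t -> normc (t%:C)%C = t.
  by move=> t0 /=; rewrite expr0n addr0 sqrtr_sqr gtr0_norm.
have ri0 : 0 < r^-1 by rewrite invr_gt0.
have -> : x = (r%:C)%C *: ((r^-1%:C)%C *: x).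
  by rewrite scalerA -rmorphM/= divff ?gt_eqF// scale1r.
rewrite hT muleC; apply: le_trans (l2normZ _ _) _; rewrite nc//.
apply: lee_wpmul2l; first by rewrite lee_fin ltW.
apply: le_trans Tc; apply: opnorm_ub; first exact: DZ.
apply: le_trans (l2normZ _ _) _; rewrite nc// E.
by rewrite -EFinM mulVf// gt_eqF.
Qed.

Definition trunc_cont T := forall x k, ccvg (fun n => T (trunc n x) k) (T x k).

(** Truncation does not increase the norm of x, so continuity of each coordinate along truncations
    suffices, by lower semicontinuity. The partial sums [psum] and [nsum] satisfy it without being
    known to be bounded. *)
Lemma opnorm_trunc_cont T : trunc_cont T ->
  opnorm setT T = opnorm (@finspan R) T.
Proof.
move=> cT; apply/eqP; rewrite eq_le; apply/andP; split; last first.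
  by apply: opnorm_le => x _ x1; exact: opnorm_ub.
apply: opnorm_le => x _ x1.
apply: (@l2norm_lim (fun n => T (trunc n x)) _ _ 0%N (cT x)) => n _.
apply: opnorm_ub; first exact: finspan_trunc.
exact: le_trans (le_trunc _ _) x1.
Qed.

Lemma trunc_contB T U : trunc_cont T -> trunc_cont U -> trunc_cont (T - U).
Proof.
move=> cT cU x k.
rewrite [X in ccvg _ X](_ : _ = T x k + -1 * U x k); last by rewrite mulN1r.
rewrite [X in ccvg X _](_ : _ = fun n => T (trunc n x) k + -1 * U (trunc n x) k).
  exact: ccvgD (cT x k) (ccvgM _ (cU x k)).
by apply/funext => n; rewrite mulN1r.
Qed.

Lemma bop_sub (a : bop R) x x' : a (x - x') = a x - a x'.
Proof.
by have := bop_linear a (-1) x' x; rewrite !scaleN1r [- x' + _]addrC [- a x' + _]addrC.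
Qed.

Lemma bop_fin (a : bop R) : exists2 c : R, 0 <= c & opnorm setT (act a) = c%:E.
Proof.
have := bop_bounded a; have := @opnorm_ge0 R setT (act a) I.
by case: opnorm => [c||]// c0 _; exists c.
Qed.

Lemma bop_trunc_cont (a : bop R) : trunc_cont (act a).
Proof.
move=> x k; apply/ccvgP => e e0; have [c c0 ac] := bop_fin a.
(* Adding 1 to [c] covers an operator of norm 0; halving leaves room for a strict inequality. *)
have d0 : 0 < e / (c + 1) / 2 by rewrite !divr_gt0// ltr_wpDl.
have [N xN] := trunc_cvg x d0; exists N => n /xN xn.
rewrite normcB -lte_fin.
rewrite (_ : act a x k - _ = act a (x - trunc n x) k); last by rewrite /act bop_sub.
apply: le_lt_trans (normc_le_l2norm _ _) _; apply: le_lt_trans (bop_le _ _) _.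
rewrite ac; apply: le_lt_trans (lee_wpmul2l _ xn) _; rewrite ?lee_fin//.
rewrite -EFinM lte_fin; set t := e / (c + 1).
have t0 : 0 < t by rewrite divr_gt0// ltr_wpDl.
have -> : e = t * (c + 1) by rewrite divfK// gt_eqF// ltr_wpDl.
by nra.
Qed.

End L2.

(** * Matrices *)

Section Matrices.
Variable R : realType.
Local Notation H := (ell2 R).
Implicit Types (x : H) (y z : int -> R[i]) (T U : H -> int -> R[i])
  (A B : int -> int -> R[i]).

(** The default 0 of [xget] off [finspan] makes [mxop] a total map; it is the action of the matrix
    only on [finspan]. *)
Definition supp_bnd x : nat :=
  xget 0%N [set n : nat | forall k : int, (n < `|k|)%N -> x k = 0].

Definition mxop A : H -> int -> R[i] :=
  fun x k => \sum_(l <- zr (supp_bnd x)) A k l * x l.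

Lemma big_zr_supp x n m (f : int -> R[i]) :
  (forall k : int, (n < `|k|)%N -> x k = 0) ->
  (forall k : int, (m < `|k|)%N -> x k = 0) ->
  \sum_(l <- zr n) f l * x l = \sum_(l <- zr m) f l * x l.
Proof.
have main p q : (p <= q)%N -> (forall k : int, (p < `|k|)%N -> x k = 0) ->
    \sum_(l <- zr p) f l * x l = \sum_(l <- zr q) f l * x l.
  move=> pq xp; rewrite (big_zr_widen _ pq) big_mkcond; apply: eq_bigr => k _.
  by case: leqP => // /xp ->; rewrite mulr0.
move=> xn xm; case: (leqP n m) => [nm|/ltnW mn]; first exact: main.
by apply/esym/main.
Qed.

Lemma mxopE A x n k : (forall k : int, (n < `|k|)%N -> x k = 0) ->
  mxop A x k = \sum_(l <- zr n) A k l * x l.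
Proof.
move=> xn; apply: big_zr_supp => //.
exact: (@xgetPex _ 0%N [set n : nat | forall k : int, (n < `|k|)%N -> x k = 0]
  (ex_intro _ n xn)).
Qed.

Definition mxnorm A : \bar R := opnorm (@finspan R) (mxop A).

Definition is_mx T A := forall x, finspan x -> T x = mxop A x.

Lemma is_mx_norm T A : is_mx T A -> opnorm (@finspan R) T = mxnorm A.
Proof.
move=> TA; rewrite /mxnorm /opnorm; congr ereal_sup; apply/seteqP.
by split => _ [x [fx x1] <-]; exists x => //; rewrite TA.
Qed.

Lemma mxnorm_ge0 A : (0 <= mxnorm A)%E.
Proof. exact: opnorm_ge0 (finspan0 R). Qed.

Lemma eq_mxnorm A B : (forall k l, A k l = B k l) -> mxnorm A = mxnorm B.
Proof. by move=> AB; congr mxnorm; apply/funext => k; apply/funext => l. Qed.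

Lemma mxop_homog A (c : R[i]) x : finspan x -> mxop A (c *: x) = c *: mxop A x.
Proof.
move=> [n xn]; apply/funext => k; rewrite (@mxopE _ _ n); last first.
  by move=> j /xn xj; rewrite [LHS](_ : _ = c * x j)// xj mulr0.
rewrite [RHS](_ : _ = c * mxop A x k)// (mxopE _ _ xn) mulr_sumr.
by apply: eq_bigr => l _; rewrite mulrCA.
Qed.

Lemma mxnorm_bound A (c : R) x : 0 <= c -> (mxnorm A <= c%:E)%E ->
  finspan x -> (l2norm (mxop A x) <= c%:E * l2norm x)%E.
Proof.
move=> c0 Ac fx; have [n xn] := fx.
(* [opnorm_bound] asks for homogeneity on all of H, while [mxop_homog] gives it on [finspan].
   Composing with [trunc n] yields a map homogeneous everywhere that agrees with [mxop A] at [x]. *)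
pose T (x : H) : int -> R[i] := fun k => \sum_(l <- zr n) A k l * trunc n x l.
have TE x' : T x' = mxop A (trunc n x').
  apply/funext => k; rewrite (@mxopE _ _ n)// => j.
  by rewrite truncE ltnNge => /negbTE ->.
rewrite -[X in mxop A X](trunc_id xn) -TE.
apply: (@opnorm_bound _ setT) => //.
  move=> d x'; rewrite !TE -mxop_homog; last exact: finspan_trunc.
  congr mxop; apply: val_inj; apply/funext => k /=; rewrite /cut.
  rewrite [RHS](_ : _ = d * (if (`|k| <= n)%N then x' k else 0))//.
  by case: ifP => //; rewrite mulr0.
apply: opnorm_le => x' _ x1; rewrite TE; apply: le_trans Ac.
by apply: opnorm_ub; [exact: finspan_trunc|exact: le_trans (le_trunc _ _) x1].
Qed.

Lemma mxnormD A B :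
  (mxnorm (fun k l => A k l + B k l)%R <= mxnorm A + mxnorm B)%E.
Proof.
rewrite (_ : mxnorm _ = opnorm (@finspan R) (mxop A + mxop B)).
  exact: opnormD.
congr opnorm.
apply/funext => x; apply/funext => k.
rewrite [RHS](_ : _ = mxop A x k + mxop B x k)// /mxop -big_split/=.
by apply: eq_bigr => l _; rewrite mulrDl.
Qed.

Lemma mxnormZ (c : R[i]) A :
  (mxnorm (fun k l => c * A k l)%R <= (normc c)%:E * mxnorm A)%E.
Proof.
rewrite (_ : mxnorm _ = opnorm (@finspan R) (c *: mxop A)).
  exact: opnormZ (finspan0 R).
congr opnorm.
apply/funext => x; apply/funext => k.
rewrite [RHS](_ : _ = c * mxop A x k)// /mxop mulr_sumr.
by apply: eq_bigr => l _; rewrite mulrA.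
Qed.

Lemma mxnorm0 : mxnorm (fun _ _ => 0) = 0%E.
Proof.
apply/eqP; rewrite eq_le mxnorm_ge0 andbT; apply: opnorm_le => x _ _.
rewrite [X in l2norm X](_ : _ = 0) ?l2norm0//; apply/funext => k.
by rewrite /mxop big1// => l _; rewrite mul0r.
Qed.

Lemma mxnorm_sum n (c : 'I_n -> R[i]) (A : 'I_n -> int -> int -> R[i]) :
  (mxnorm (fun k l => \sum_(i < n) c i * A i k l)%R
     <= \sum_(i < n) (normc (c i))%:E * mxnorm (A i))%E.
Proof.
elim: n c A => [|n IHn] c A.
  rewrite big_ord0 (@eq_mxnorm _ (fun _ _ => 0)) ?mxnorm0//.
  by move=> k l; rewrite big_ord0.
rewrite big_ord_recl; under eq_mxnorm do rewrite big_ord_recl.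
by apply: le_trans (mxnormD _ _) _; apply: leeD; [exact: mxnormZ|exact: IHn].
Qed.

(** Truncating at |l| leaves the basis vector unchanged and supplies its square summability. *)
Definition ebasis (l : int) : H := trunc `|l| (basis_vec R l).

Lemma ebasisE l k : ebasis l k = (k == l)%:R.
Proof.
rewrite /ebasis truncE /basis_vec; case: eqP => [->|_]; first by rewrite leqnn.
by rewrite if_same.
Qed.

Lemma ebasis_supp l k : (`|l| < `|k|)%N -> ebasis l k = 0.
Proof. by rewrite ebasisE; case: eqP => // ->; rewrite ltnn. Qed.

Lemma finspan_ebasis l : finspan (ebasis l).
Proof. by exists `|l|%N => k; exact: ebasis_supp. Qed.

Lemma l2norm_ebasis l : (l2norm (ebasis l) <= 1)%E.
Proof.
apply/(l2norm_leP _ (@ler01 R)) => n; rewrite (big_zr_pick _ (l := l)).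
  by case: ifP => _; rewrite ?ebasisE ?eqxx ?normc1 expr1n// ler01.
by move=> k kl; rewrite ebasisE (negbTE kl) normc0 expr0n.
Qed.

Lemma mxop_ebasis A k l : mxop A (ebasis l) k = A k l.
Proof.
rewrite (mxopE _ _ (@ebasis_supp l)) (big_zr_pick _ (l := l)).
  by rewrite leqnn ebasisE eqxx mulr1.
by move=> j jl; rewrite ebasisE (negbTE jl) mulr0.
Qed.

Lemma mxnorm_entry A k l : ((normc (A k l))%:E <= mxnorm A)%E.
Proof.
rewrite -mxop_ebasis; apply: le_trans (normc_le_l2norm _ _) _.
by apply: opnorm_ub; [exact: finspan_ebasis|exact: l2norm_ebasis].
Qed.

Definition lin T := forall (c : R[i]) x x', T (c *: x + x') = c *: T x + T x'.

Lemma lin0 T : lin T -> T 0 = 0.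
Proof.
by move=> /(_ (-1) 0 0); rewrite scaler0 addr0 scaleN1r addNr.
Qed.

Lemma lin_homog T : lin T -> homog T.
Proof.
by move=> lT c x; have := lT c x 0; rewrite lin0// !addr0.
Qed.

Lemma ebasis_sum x n : (forall k : int, (n < `|k|)%N -> x k = 0) ->
  x = \sum_(l <- zr n) x l *: ebasis l.
Proof.
move=> xn; apply: val_inj; apply/funext => k /=.
have cs (r : seq int) : coords (\sum_(l <- r) x l *: ebasis l) k =
    \sum_(l <- r) x l * ebasis l k.
  by elim: r => [|l r IHr]; rewrite ?big_nil// !big_cons -IHr.
rewrite cs (big_zr_pick _ (l := k)).
  by case: leqP => [_|/xn//]; rewrite ebasisE eqxx mulr1.
by move=> l lk; rewrite ebasisE eq_sym (negbTE lk) mulr0.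
Qed.

Lemma lin_is_mx T : lin T -> is_mx T (fun k l => T (ebasis l) k).
Proof.
move=> lT x [n xn]; apply/funext => k; rewrite (mxopE _ _ xn).
rewrite {1}(ebasis_sum xn); elim: (zr n) => [|l r IHr].
  by rewrite !big_nil lin0.
rewrite !big_cons lT -IHr mulrC.
by rewrite [LHS](_ : _ = x l * T (ebasis l) k + T (\sum_(j <- r) x j *: ebasis j) k).
Qed.

(** On a fixed finitely supported x every coordinate of [mxop] is a finite combination of entries,
    so [l2norm_lim] applies vector by vector. *)
Lemma mxnorm_lim (A : nat -> int -> int -> R[i]) B (c : \bar R) N :
  (forall k l, ccvg (fun n => A n k l) (B k l)) ->
  (forall n, (N <= n)%N -> (mxnorm (A n) <= c)%E) -> (mxnorm B <= c)%E.
Proof.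
move=> AB Ac; apply: opnorm_le => x fx x1.
apply: (@l2norm_lim _ (fun n => mxop (A n) x) _ _ N).
  move=> k; apply: ccvg_sum => l.
  under eq_fun do rewrite mulrC; rewrite mulrC; exact: ccvgM.
by move=> n /Ac; apply: le_trans; exact: opnorm_ub.
Qed.

(** On [finspan] the truncated product acts as [mxop A] after [trunc n] after [mxop B], and the
    truncation brings the middle vector back into [finspan]. *)
Lemma mxnorm_mul A B n (a b : R) : 0 <= a -> 0 <= b ->
  (mxnorm A <= a%:E)%E -> (mxnorm B <= b%:E)%E ->
  (mxnorm (fun k l => \sum_(p <- zr n) A k p * B p l)%R <= (a * b)%:E)%E.
Proof.
move=> a0 b0 Aa Bb; apply: opnorm_le => x fx x1.
rewrite [X in l2norm X](_ : _ = mxop A (trunc n (mxop B x))).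
  apply: le_trans (mxnorm_bound a0 Aa (finspan_trunc _ _)) _.
  rewrite EFinM; apply: lee_wpmul2l => //; apply: le_trans (le_trunc _ _) _.
  by apply: le_trans Bb; exact: opnorm_ub.
apply/funext => k; have [m xm] := fx.
rewrite (mxopE _ _ xm) (@mxopE _ _ n); last first.
  by move=> j; rewrite truncE ltnNge => /negbTE ->.
under eq_bigr do rewrite mulr_suml.
rewrite exchange_big big_seq [RHS]big_seq; apply: eq_bigr => p.
rewrite mem_zr truncE => ->; rewrite (mxopE _ _ xm) mulr_sumr.
by apply: eq_bigr => l _; rewrite mulrA.
Qed.

Lemma sum_normc_le1 x n : (l2norm x <= 1)%E ->
  \sum_(k <- zr n) normc (x k) ^+ 2 <= 1.
Proof. by move=> /(l2norm_leP _ (@ler01 R))/(_ n); rewrite expr1n. Qed.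

(** Schur's test: Cauchy-Schwarz, with each |A_kl| split into two square roots, takes one factor [C]
    from the row sums; after exchanging the sums, the column sums give the other. *)
Lemma mxnorm_schur A (C : R) : 0 <= C ->
  (forall k n, \sum_(l <- zr n) normc (A k l) <= C) ->
  (forall l n, \sum_(k <- zr n) normc (A k l) <= C) -> (mxnorm A <= C%:E)%E.
Proof.
move=> C0 Ar Ac; apply: opnorm_le => x [m xm] x1; apply/l2norm_leP => // n.
have rowle k : normc (mxop A x k) ^+ 2 <=
    C * \sum_(l <- zr m) normc (A k l) * normc (x l) ^+ 2.
  rewrite (mxopE _ _ xm).
  apply: (@le_trans _ _ ((\sum_(l <- zr m) normc (A k l) * normc (x l)) ^+ 2)).
    rewrite ler_sqr ?nnegrE ?normc_ge0//; last first.
      by apply: sumr_ge0 => l _; rewrite mulr_ge0 ?normc_ge0.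
    apply: le_trans (normc_sum _ _ _) _.
    by apply: ler_sum => l _; rewrite normcM.
  have := sum_CS (zr m) (fun l => Num.sqrt (normc (A k l)))
    (fun l => Num.sqrt (normc (A k l)) * normc (x l)).
  under eq_bigr do rewrite mulrA -expr2 sqr_sqrtr ?normc_ge0//.
  under [X in _ <= X * _ -> _]eq_bigr do rewrite sqr_sqrtr ?normc_ge0//.
  under [X in _ <= _ * X -> _]eq_bigr do rewrite exprMn sqr_sqrtr ?normc_ge0//.
  move=> /le_trans; apply; apply: ler_wpM2r => //.
  by apply: sumr_ge0 => l _; rewrite mulr_ge0 ?normc_ge0 ?sqr_ge0.
apply: (@le_trans _ _ (C * \sum_(k <- zr n) \sum_(l <- zr m)
    normc (A k l) * normc (x l) ^+ 2)).
  by rewrite mulr_sumr; apply: ler_sum => k _.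
rewrite expr2; apply: ler_wpM2l => //; rewrite exchange_big/=.
apply: (@le_trans _ _ (C * \sum_(l <- zr m) normc (x l) ^+ 2)).
  rewrite mulr_sumr; apply: ler_sum => l _; rewrite -mulr_suml.
  by apply: ler_wpM2r; rewrite ?sqr_ge0.
by rewrite -[leRHS]mulr1; apply: ler_wpM2l => //; exact: sum_normc_le1.
Qed.

Lemma mxnorm_adj A : (mxnorm (fun k l => ((A l k)^*)%C) <= mxnorm A)%E.
Proof.
case E : (mxnorm A) => [c||]; last 2 first.
- by rewrite leey.
- by have := mxnorm_ge0 A; rewrite E.
have c0 : 0 <= c by rewrite -lee_fin -E mxnorm_ge0.
have Ac : (mxnorm A <= c%:E)%E by rewrite E.
apply: opnorm_le => x [m xm] x1; apply/l2norm_leP => // n.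
set y := mxop _ x; set S := \sum_(k <- zr n) _.
have S0 : 0 <= S by apply: sumr_ge0 => k _; rewrite sqr_ge0.
pose z := trunc n y; pose w := mxop A z.
have wE l : w l = \sum_(k <- zr n) A l k * y k.
  rewrite /w (@mxopE _ _ n).
    by rewrite !big_seq; apply: eq_bigr => k; rewrite mem_zr truncE => ->.
  by move=> j; rewrite truncE ltnNge => /negbTE ->.
(* Duality: [S], the squared norm of [z], is also the pairing of [x] with A z. Its modulus is at
   most |x| |A z| <= [c] times the root of [S], whence [S ^+ 2 <= c ^+ 2 * S]. *)
have SE : (S%:C)%C = \sum_(l <- zr m) x l * (w l)^*%C.
  rewrite rmorph_sum/=.
  under [RHS]eq_bigr do rewrite wE rmorph_sum mulr_sumr/=.
  rewrite exchange_big/=; apply: eq_bigr => k _.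
  rewrite -mulcJ_normc {1}/y (mxopE _ _ xm) mulr_suml; apply: eq_bigr => l _.
  by rewrite rmorphM/= mulrA [x l * _]mulrC.
have zS : (l2norm z <= (Num.sqrt S)%:E)%E.
  apply/(l2norm_leP _ (sqrtr_ge0 _)) => p; rewrite sqr_sqrtr//.
  have zp k : normc (z k) ^+ 2 = if (`|k| <= n)%N then normc (y k) ^+ 2 else 0.
    by rewrite truncE; case: ifP; rewrite // normc0 expr0n.
  under eq_bigr do rewrite zp; rewrite /S.
  rewrite (big_zr_widen _ (leq_maxl n p)) (big_zr_widen _ (leq_maxr n p)).
  rewrite big_mkcond [leRHS]big_mkcond/=; apply: ler_sum => k _.
  by case: ifP => // _; case: ifP => // _; rewrite sqr_ge0.
have wS : \sum_(l <- zr m) normc (w l) ^+ 2 <= c ^+ 2 * S.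
  have : (l2norm w <= (c * Num.sqrt S)%:E)%E.
    apply: le_trans (mxnorm_bound c0 Ac (finspan_trunc _ _)) _.
    by rewrite EFinM; apply: lee_wpmul2l.
  move=> /l2norm_leP; rewrite mulr_ge0 ?sqrtr_ge0// => /(_ isT m).
  by rewrite exprMn sqr_sqrtr.
have SS : S ^+ 2 <= c ^+ 2 * S.
  have -> : S = normc (S%:C)%C by rewrite /= expr0n addr0 sqrtr_sqr ger0_norm.
  rewrite {1}SE.
  apply: (@le_trans _ _ ((\sum_(l <- zr m) normc (x l) * normc (w l)) ^+ 2)).
    rewrite ler_sqr ?nnegrE ?normc_ge0//; last first.
      by apply: sumr_ge0 => l _; rewrite mulr_ge0 ?normc_ge0.
    apply: le_trans (normc_sum _ _ _) _.
    by apply: ler_sum => l _; rewrite normcM normcJ.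
  apply: le_trans (sum_CS _ _ _) _.
  rewrite [normc _](_ : _ = S); last by rewrite /= expr0n addr0 sqrtr_sqr ger0_norm.
  rewrite -[leRHS]mul1r; apply: ler_pM => //.
  - by apply: sumr_ge0 => l _; rewrite sqr_ge0.
  - by apply: sumr_ge0 => l _; rewrite sqr_ge0.
  - exact: sum_normc_le1.
have [->|Sn0] := eqVneq S 0; first by rewrite sqr_ge0.
by rewrite expr2 ler_pM2r// in SS; rewrite lt_neqAle eq_sym Sn0.
Qed.

End Matrices.

(** * The norms |a|_{M,N} in terms of matrices *)

Section BinomialSums.
Variable R : realType.
Implicit Types f g : nat -> \bar R.

Definition bsum (M : nat) f : \bar R :=
  (\sum_(j < M.+1) ('C(M, j)%:R)%:E * f j)%E.

Lemma bsum_ge0 M f : (forall j, 0 <= f j)%E -> (0 <= bsum M f)%E.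
Proof.
by move=> f0; apply: sume_ge0 => j _; rewrite mule_ge0// lee_fin.
Qed.

Lemma le_bsum M f g : (forall j, (j <= M)%N -> (f j <= g j)%E) ->
  (bsum M f <= bsum M g)%E.
Proof.
move=> fg; apply: lee_sum => j _; apply: lee_wpmul2l; rewrite ?lee_fin//.
by apply: fg; rewrite -ltnS ltn_ord.
Qed.

(** Pascal's rule; it gives the recursion of the norms in M. *)
Lemma bsumS M f : (forall j, 0 <= f j)%E ->
  bsum M.+1 f = (bsum M f + bsum M (fun j => f j.+1))%E.
Proof.
move=> f0; rewrite {1}/bsum big_ord_recl bin0.
have -> : bsum M f = (1%:E * f 0%N +
    \sum_(j < M.+1) ('C(M, j.+1)%:R)%:E * f j.+1)%E.
  rewrite /bsum [in RHS]big_ord_recr/= bin_small// mul0e adde0 big_ord_recl bin0.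
  by congr (_ + _)%E.
rewrite -addeA; congr (_ + _)%E; rewrite /bsum -big_split/=.
apply: eq_bigr => j _; rewrite -ge0_muleDl ?lee_fin// -EFinD -natrD.
by rewrite -binS.
Qed.

Lemma bsumD M f g : (forall j, 0 <= f j)%E -> (forall j, 0 <= g j)%E ->
  bsum M (fun j => f j + g j)%E = (bsum M f + bsum M g)%E.
Proof.
move=> f0 g0; rewrite /bsum -big_split/=; apply: eq_bigr => j _.
by rewrite ge0_muleDr.
Qed.

(** Vandermonde's convolution of binomial coefficients, obtained by iterating Pascal's rule. *)
Lemma bsum_bsum M N f : (forall j, 0 <= f j)%E ->
  bsum M (fun i => bsum N (fun j => f (i + j)%N)) = bsum (M + N) f.
Proof.
elim: M f => [|M IHM] f f0.
  by rewrite {1}/bsum big_ord_recl big_ord0 adde0 bin0 mul1e.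
rewrite bsumS => [|i]; last exact: bsum_ge0.
by rewrite IHM// (IHM (fun j => f j.+1))// addSn bsumS.
Qed.

(* The terms of the Leibniz rule for the j-th derivative of a product; the
   recursion differentiates one factor at a time. *)
Fixpoint leibniz (j : nat) f g : \bar R :=
  if j is j'.+1 then
    (leibniz j' (fun i => f i.+1) g + leibniz j' f (fun i => g i.+1))%E
  else (f 0%N * g 0%N)%E.

Lemma leibniz_ge0 j f g : (forall i, 0 <= f i)%E -> (forall i, 0 <= g i)%E ->
  (0 <= leibniz j f g)%E.
Proof.
elim: j f g => [|j IHj] f g f0 g0 /=; first exact: mule_ge0.
by rewrite adde_ge0// IHj.
Qed.

(** In the step, Pascal's rule splits the left side into the sums for (f, g), (f', g) and (f, g'),
    where the prime shifts the index. The right side expands into four products, and the one of f'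
    with g' is dropped. *)
Lemma bsum_leibniz M f g : (forall i, 0 <= f i)%E -> (forall i, 0 <= g i)%E ->
  (bsum M (fun j => leibniz j f g) <= bsum M f * bsum M g)%E.
Proof.
elim: M f g => [|M IHM] f g f0 g0.
  by rewrite /bsum !big_ord_recl !big_ord0 !adde0 bin0 !mul1e.
have L0 := leibniz_ge0 _ f0 g0.
rewrite !bsumS//= bsumD; try by move=> j; apply: leibniz_ge0.
rewrite ge0_muleDr ?bsum_ge0// !ge0_muleDl ?bsum_ge0//.
rewrite -addeA; apply: leeD; first exact: IHM.
apply: leeD; first exact: IHM.
apply: le_trans (IHM _ _ _ _) _ => //.
by rewrite leeDl// mule_ge0// bsum_ge0.
Qed.

End BinomialSums.

(** * The norms as binomial sums of weighted matrix norms, and their inequalities *)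

Section SmoothNorms.
Variables (R : realType) (s : nat).
Local Notation H := (ell2 R).
Local Notation v := (sadic_val s).
Implicit Types (a b : bop R) (T : H -> int -> R[i]) (A B : int -> int -> R[i])
  (x : H).

Definition ent a k l : R[i] := act a (ebasis R l) k.

Lemma bop_lin a : lin (act a).
Proof. by move=> c x x'; rewrite /act bop_linear. Qed.

Lemma bop_is_mx a : is_mx (act a) (ent a).
Proof. exact/lin_is_mx/bop_lin. Qed.

(* The matrix of delta_P^j (a) for A the matrix of a. *)
Definition derivmx j A k l : R[i] := ((v k)%:R - (v l)%:R) ^+ j * A k l.

(* The matrix of a (1 + P)^N for A the matrix of a. *)
Definition weightmx N A k l : R[i] := A k l * (1 + (v l)%:R) ^+ N.

Lemma PH_supp x n : (forall k : int, (n < `|k|)%N -> x k = 0) ->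
  (forall k : int, (n < `|k|)%N -> PH s x k = 0) /\
  forall k, PH s x k = (v k)%:R * x k.
Proof.
move=> xn; have PE : coords (PH s x) = Pop s x by apply: PHE; exists n.
by split=> k; rewrite PE /Pop// => /xn ->; rewrite mulr0.
Qed.

Lemma is_mx_delta T A : is_mx T A ->
  is_mx (delta s T) (fun k l => ((v k)%:R - (v l)%:R) * A k l).
Proof.
move=> TA x fx; have [n xn] := fx; have [Pn PE] := PH_supp xn.
apply/funext => k; rewrite (mxopE _ _ xn).
rewrite [LHS](_ : _ = (v k)%:R * T x k - T (PH s x) k)//.
rewrite TA// TA; last by exists n.
rewrite (mxopE _ _ xn) (mxopE _ _ Pn) mulr_sumr -sumrB.
by apply: eq_bigr => l _; rewrite PE; ring.
Qed.

Lemma is_mx_iter_delta T A j : is_mx T A -> is_mx (iter j (delta s) T) (derivmx j A).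
Proof.
move=> TA; elim: j => [|j IHj].
  rewrite (_ : derivmx 0 A = A)//; apply/funext => k; apply/funext => l.
  by rewrite /derivmx expr0 mul1r.
rewrite iterS (_ : derivmx j.+1 A = fun k l => ((v k)%:R - (v l)%:R) * derivmx j A k l).
  exact: is_mx_delta.
by apply/funext => k; apply/funext => l; rewrite /derivmx exprS mulrA.
Qed.

Local Notation shift := (fun y : H => y + PH s y).

Lemma is_mx_shift T A N : is_mx T A -> is_mx (fun x => T (iter N shift x)) (weightmx N A).
Proof.
move=> TA; elim: N => [|N IHN] x fx.
  rewrite /= TA//; congr mxop; apply/funext => k; apply/funext => l.
  by rewrite /weightmx expr0 mulr1.
have [n xn] := fx; have [Pn PE] := PH_supp xn.
have yE k : (x + PH s x) k = (1 + (v k)%:R) * x k.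
  by rewrite [LHS](_ : _ = x k + PH s x k)// PE mulrDl mul1r.
have yn (k : int) : (n < `|k|)%N -> (x + PH s x) k = 0.
  by move=> /xn xk; rewrite yE xk mulr0.
rewrite iterSr IHN; last by exists n.
apply/funext => k; rewrite (mxopE _ _ xn) (mxopE _ _ yn).
by apply: eq_bigr => l _; rewrite yE /weightmx exprSr !mulrA.
Qed.

Lemma normN_mx T A j N : is_mx T A ->
  normN s N (iter j (delta s) T) = mxnorm (weightmx N (derivmx j A)).
Proof. by move=> TA; apply/is_mx_norm/is_mx_shift/is_mx_iter_delta. Qed.

Lemma normMN_mx a M N :
  normMN s M N (act a) = bsum M (fun j => mxnorm (weightmx N (derivmx j (ent a)))).
Proof.
by apply: eq_bigr => j _; rewrite (normN_mx _ _ (bop_is_mx a)).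
Qed.

Lemma normMN_S M N T : normMN s M.+1 N T =
  (normMN s M N T + normMN s M N (delta s T))%E.
Proof.
rewrite [LHS](_ : _ = bsum M.+1 (fun j => normN s N (iter j (delta s) T)))//.
rewrite bsumS => [|j]; last exact: normN_ge0.
by congr (_ + _)%E; apply: eq_bigr => j _; congr (_ * normN s N _)%E; exact: iterSr.
Qed.

(** On [finspan] the operator 1 + P is invertible and its inverse is a contraction: x = (1 + P) y
    with |y| <= |x|. *)
Lemma normN_le N T : (normN s N T <= normN s N.+1 T)%E.
Proof.
apply: opnorm_le => x [n xn] x1.
pose y := trunc n (fun k => x k / (1 + (v k)%:R)).
have v0 k : 1 + (v k)%:R != 0 :> R[i] by rewrite -(natrD _ 1) pnatr_eq0.
have yn (k : int) : (n < `|k|)%N -> y k = 0.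
  by rewrite truncE ltnNge => /negbTE ->.
have [_ PE] := PH_supp yn.
have -> : x = shift y.
  apply: val_inj; apply/funext => k /=.
  rewrite [RHS](_ : _ = y k + PH s y k)// PE truncE.
  case: leqP => [kn|/xn ->]; last by rewrite mulr0 addr0.
  by rewrite -[X in X + _]mul1r -mulrDl mulrC divfK.
rewrite -iterSr; apply: opnorm_ub; first exact: finspan_trunc.
apply: le_trans x1; apply: le_trans (le_trunc _ _) _; apply: le_l2norm => k.
have h : normc (x k / (1 + (v k)%:R)) * normc (1 + (v k)%:R) = normc (x k).
  by rewrite -normcM divfK.
rewrite -h -(natrD _ 1) normc_nat ler_peMr ?normc_ge0//.
by rewrite natrD lerDl.
Qed.

Lemma normN_mono N N' T : (N <= N')%N -> (normN s N T <= normN s N' T)%E.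
Proof.
elim: N' => [|N' IHN']; first by rewrite leqn0 => /eqP ->.
rewrite leq_eqVlt => /predU1P[->//|/IHN' /le_trans]; apply; exact: normN_le.
Qed.

Lemma normMN_mono M N N' T : (N <= N')%N -> (normMN s M N T <= normMN s M N' T)%E.
Proof.
move=> NN'; apply: (@le_bsum _ M (fun j => normN s N (iter j (delta s) T))
  (fun j => normN s N' (iter j (delta s) T))) => j _; exact: normN_mono.
Qed.

(** With values in the extended reals, 0 times +oo is 0. The cases of norm 0 are therefore treated
    first: there all entries vanish, and so does the product. *)
Lemma mxnorm_mule A B n :
  (mxnorm (fun k l => \sum_(p <- zr n) A k p * B p l)%R <= mxnorm A * mxnorm B)%E.
Proof.
have z (C : int -> int -> R[i]) : mxnorm C = 0%E -> forall k l, C k l = 0.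
  move=> C0 k l; apply: ComplexField.Normc.eq0_normc; apply/eqP.
  by have := mxnorm_entry C k l; rewrite C0 lee_fin eq_le normc_ge0 andbT.
have [/z A0|An0] := eqVneq (mxnorm A) 0%E.
  rewrite (@eq_mxnorm _ _ (fun _ _ => 0)) ?mxnorm0 ?mule_ge0 ?mxnorm_ge0// => k l.
  by rewrite big1// => p _; rewrite A0 mul0r.
have [/z B0|Bn0] := eqVneq (mxnorm B) 0%E.
  rewrite (@eq_mxnorm _ _ (fun _ _ => 0)) ?mxnorm0 ?mule_ge0 ?mxnorm_ge0// => k l.
  by rewrite big1// => p _; rewrite B0 mulr0.
have := mxnorm_ge0 A; have := mxnorm_ge0 B.
case EA : (mxnorm A) An0 => [a||]// An0; last first.
  by move=> b0 _; rewrite gt0_mulye ?leey// lt_neqAle eq_sym Bn0.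
case EB : (mxnorm B) Bn0 => [b||]// Bn0 b0 a0; last first.
  by rewrite gt0_muley ?leey// lt_neqAle eq_sym An0.
rewrite -EFinM; apply: mxnorm_mul; rewrite ?EA ?EB//.
Qed.

(** One derivative multiplies the (k, l) entry by v(k) - v(l) = (v(k) - v(p)) + (v(p) - v(l)), so it
    falls on [A] or on [B]. The weight depends on l only and stays with [B]. *)
Lemma mxnorm_leibniz A B n N j :
  (mxnorm (weightmx N (derivmx j (fun k l => \sum_(p <- zr n) A k p * B p l)%R))
    <= leibniz j (fun i => mxnorm (weightmx 0 (derivmx i A)))
        (fun i => mxnorm (weightmx N (derivmx i B))))%E.
Proof.
elim: j A B => [|j IHj] A B.
  apply: le_trans (mxnorm_mule _ _ n); rewrite le_eqVlt; apply/orP; left; apply/eqP.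
  apply: eq_mxnorm => k l; rewrite /weightmx /derivmx !expr0 mul1r mulr_suml.
  by apply: eq_bigr => p _; rewrite !mul1r mulr1 mulrA.
pose D C k l : R[i] := ((v k)%:R - (v l)%:R) * C k l.
have dS i C : derivmx i (D C) = derivmx i.+1 C.
  by apply/funext => k; apply/funext => l; rewrite /derivmx /D exprSr mulrA.
have dE m C : (fun i => mxnorm (weightmx m (derivmx i.+1 C))) =
    (fun i => mxnorm (weightmx m (derivmx i (D C)))).
  by apply/funext => i; rewrite dS.
rewrite [leibniz _ _ _]/= (dE 0%N A) (dE N B).
apply: le_trans (leeD (IHj _ _) (IHj _ _)).
apply: le_trans (mxnormD _ _); rewrite le_eqVlt; apply/orP; left; apply/eqP.
apply: eq_mxnorm => k l; rewrite -dS /weightmx /derivmx -mulrDl -mulrDr; congr (_ * _ * _).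
rewrite /D -big_split mulr_sumr/=; apply: eq_bigr => p _; ring.
Qed.

Lemma ent_bmul a b k l :
  ccvg (fun n => \sum_(p <- zr n) ent a k p * ent b p l) (ent (bmul a b) k l).
Proof.
rewrite (_ : (fun n => _) = (fun n => act a (trunc n (act b (ebasis R l))) k)).
  exact: (@bop_trunc_cont R a (b (ebasis R l)) k).
apply/funext => n; rewrite bop_is_mx; last exact: finspan_trunc.
rewrite (@mxopE _ _ _ n) => [|p]; last by rewrite truncE ltnNge => /negbTE ->.
by rewrite !big_seq; apply: eq_bigr => p; rewrite mem_zr truncE => ->.
Qed.

Lemma normMN_bmul a b M N :
  (normMN s M N (act (bmul a b)) <= normMN s M 0 (act a) * normMN s M N (act b))%E.
Proof.
rewrite !normMN_mx; apply: le_trans (bsum_leibniz _ _ _) => [|j|j]; try exact: mxnorm_ge0.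
apply: le_bsum => j _; apply: (@mxnorm_lim _ _ _ _ 0%N); last first.
  by move=> n _; exact: mxnorm_leibniz.
move=> k l; rewrite /weightmx /derivmx; under eq_fun do rewrite mulrC; rewrite mulrC.
by apply: ccvgM; apply: ccvgM; exact: ent_bmul.
Qed.

Lemma inner_ebasisr (x : H) l : inner x (ebasis R l) = x l.
Proof.
(* The partial sums are constant from n = |l| on. *)
rewrite /inner; apply: (lim_near_cst (@norm_hausdorff R[i] R[i]^o)).
exists `|l|%N => // n /= ln.
rewrite -(big_mkord xpredT (fun i => x (i%:Z - n%:Z) * ((ebasis R l (i%:Z - n%:Z))^*)%C)).
rewrite /index_iota subn0 -(big_map (fun i : nat => i%:Z - n%:Z) xpredT
  (fun k => x k * ((ebasis R l k)^*)%C)) (big_zr_pick _ (l := l)).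
  by rewrite ln ebasisE eqxx rmorph1 mulr1.
by move=> k kl; rewrite ebasisE (negbTE kl) rmorph0 mulr0.
Qed.

Lemma inner_ebasisl (x : H) l : inner (ebasis R l) x = ((x l)^*)%C.
Proof.
rewrite /inner; apply: (lim_near_cst (@norm_hausdorff R[i] R[i]^o)).
exists `|l|%N => // n /= ln.
rewrite -(big_mkord xpredT (fun i => ebasis R l (i%:Z - n%:Z) * ((x (i%:Z - n%:Z))^*)%C)).
rewrite /index_iota subn0 -(big_map (fun i : nat => i%:Z - n%:Z) xpredT
  (fun k => ebasis R l k * ((x k)^*)%C)) (big_zr_pick _ (l := l)).
  by rewrite ln ebasisE eqxx mul1r.
by move=> k kl; rewrite ebasisE (negbTE kl) mul0r.
Qed.

Lemma ent_adj a b k l : is_adjoint a b -> ent b k l = ((ent a l k)^*)%C.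
Proof.
move=> /(_ (ebasis R k) (ebasis R l)); rewrite inner_ebasisr inner_ebasisl => h.
by rewrite /ent /act h conjcK.
Qed.

(** Moving the weight from the row index to the column index costs up to N further derivatives, the
    source of M + N in the bound for the adjoint. The terms carry the exponents N - j, which are
    raised to N by monotonicity. *)
Lemma mxnorm_weight_left A i N :
  (mxnorm (fun k l => (derivmx i A k l) * (1 + (v k)%:R) ^+ N)%R
     <= bsum N (fun j => mxnorm (weightmx N (derivmx (i + j) A))))%E.
Proof.
pose c (j : 'I_N.+1) : R[i] := 'C(N, j)%:R.
rewrite (@eq_mxnorm _ _ (fun k l =>
    \sum_(j < N.+1) c j * weightmx (N - j) (derivmx (i + j) A) k l)).
  apply: le_trans (mxnorm_sum _ _) _; apply: lee_sum => j _; rewrite normc_nat.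
  apply: lee_wpmul2l; first by rewrite lee_fin.
  pose T := mxop A; have TA : is_mx T A by [].
  by rewrite -!(normN_mx _ _ TA); apply: normN_mono; rewrite leq_subr.
move=> k l; have -> : 1 + (v k)%:R = (1 + (v l)%:R) + ((v k)%:R - (v l)%:R) :> R[i] by ring.
rewrite exprDn mulr_sumr; apply: eq_bigr => j _; rewrite /c /weightmx /derivmx -mulr_natl exprD.
by ring.
Qed.

Lemma normMN_adj a b M N : is_adjoint a b ->
  (normMN s M N (act b) <= normMN s (M + N) N (act a))%E.
Proof.
move=> ab; rewrite !normMN_mx -bsum_bsum => [|j]; last exact: mxnorm_ge0.
apply: le_bsum => i _; apply: le_trans (mxnorm_weight_left _ _ _).
(* The sign compensates for the transposition, which turns v(k) - v(l) into its opposite. *)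
pose B k l := (-1) ^+ i * (derivmx i (ent a) k l * (1 + (v k)%:R) ^+ N).
apply: (@le_trans _ _ (mxnorm B)).
  apply: le_trans (mxnorm_adj B); rewrite le_eqVlt; apply/orP; left; apply/eqP.
  apply: eq_mxnorm => k l; rewrite /weightmx /derivmx /B /derivmx (ent_adj _ _ ab).
  rewrite !rmorphM !rmorphXn !rmorphD !rmorphN rmorph1 !rmorph_nat/=.
  by rewrite !mulrA -exprMn mulN1r opprB.
apply: le_trans (mxnormZ _ _) _.
by rewrite normcX normcN normc1 expr1n mul1e.
Qed.

Lemma normMNZ (c : R[i]) a M N :
  (normMN s M N (act (c *: a)) <= (normc c)%:E * normMN s M N (act a))%E.
Proof.
rewrite !normMN_mx /bsum ge0_sume_distrr; last first.
  by move=> j _; rewrite mule_ge0 ?lee_fin ?mxnorm_ge0.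
apply: lee_sum => j _; rewrite muleCA; apply: lee_wpmul2l; first by rewrite lee_fin.
apply: le_trans (mxnormZ _ _); rewrite le_eqVlt; apply/orP; left; apply/eqP.
apply: eq_mxnorm => k l.
by rewrite /weightmx /derivmx [ent _ k l](_ : _ = c * ent a k l)//; ring.
Qed.

End SmoothNorms.

(** * Matrices supported on the diagonals k / l = s^n *)

Section SadicArithmetic.
Variable s : nat.
Hypothesis hs : (1 < s)%N.
Local Notation v := (sadic_val s).
Local Notation sp := (spart s).

Lemma expz_neq0 n : (s ^ n)%N%:Z != 0.
Proof. by rewrite eqz_nat -lt0n expn_gt0 (ltnW hs). Qed.

Lemma dvdz_expS n q : (s%:Z %| (s ^ n.+1)%N%:Z * q)%Z.
Proof. by rewrite expnS PoszM -mulrA dvdz_mulr. Qed.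

(** After cancelling the smaller power, any power of [s] left over would make [s] divide [q]. Only
    divisibility by [s] itself enters, so [s] may be composite. *)
Lemma sadic_uniq m m' (q q' : int) : ~~ (s%:Z %| q)%Z -> ~~ (s%:Z %| q')%Z ->
  (s ^ m)%N%:Z * q = (s ^ m')%N%:Z * q' -> m = m' /\ q = q'.
Proof.
wlog mm : m m' q q' / (m <= m')%N.
  move=> W sq sq' E; case: (leqP m m') => [|/ltnW] mm; first exact: W.
  by have [] := W _ _ _ _ mm sq' sq (esym E).
move=> sq sq'; rewrite -(subnK mm) expnD PoszM mulrAC mulrC => /(mulIf (expz_neq0 m)).
case: (m' - m)%N => [|i] E; first by rewrite expn0 mul1r in E.
by rewrite E dvdz_expS in sq.
Qed.

Lemma sadic_eq m (q : int) : ~~ (s%:Z %| q)%Z ->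
  v ((s ^ m)%N%:Z * q) = m /\ sp ((s ^ m)%N%:Z * q) = q.
Proof.
move=> sq; set l := _ * q.
have q0 : q != 0 by apply: contraNneq sq => ->; rewrite dvdz0.
have l0 : l != 0 by rewrite mulf_neq0// expz_neq0.
apply: (sadic_uniq (spart_ndvd hs l0) sq).
by rewrite -sadic_val_spartE.
Qed.

Lemma sadic_exp_mul n l : l != 0 ->
  v ((s ^ n)%N%:Z * l) = (n + v l)%N /\ sp ((s ^ n)%N%:Z * l) = sp l.
Proof.
move=> l0; rewrite {1 3}(sadic_val_spartE s l) mulrA -PoszM -expnD.
exact: sadic_eq (spart_ndvd hs l0).
Qed.

Lemma sadic_ratio k l : sp k = sp l -> (v l <= v k)%N ->
  k = (s ^ (v k - v l))%N%:Z * l.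
Proof.
move=> kl lk; rewrite {1}(sadic_val_spartE s k) kl {3}(sadic_val_spartE s l).
by rewrite mulrA -PoszM -expnD subnK.
Qed.

End SadicArithmetic.

(** * Entries of the partial sums, and Schur's test along the diagonals *)

Section DiagonalMatrices.
Variables (R : realType) (s : nat).
Hypothesis hs : (1 < s)%N.
Local Notation H := (ell2 R).
Local Notation v := (sadic_val s).
Local Notation sp := (spart s).
Local Notation X := (nat * {ptws nat -> nat})%type.
Implicit Types (F : int -> X -> R[i]) (f : X -> R[i]) (y : int -> R[i]) (x : H).

(* The matrix of an element of I_s^oo: its nonzero entries (k, l) are those
   with k / l = s ^ n for some integer n, where it is given by F_n. *)
Definition dmx F (k l : int) : R[i] :=
  if [&& k != 0, l != 0 & sp k == sp l]
  then F ((v k)%:Z - (v l)%:Z) (minn (v k) (v l), digits s (sp k)) else 0.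

Lemma V_basisZ n (c : R[i]) l :
  iter n (V s) (c *: basis_vec R l) = c *: basis_vec R ((s ^ n)%N%:Z * l).
Proof.
elim: n => [|n IHn]; first by rewrite expn0 mul1r.
rewrite iterS IHn expnS PoszM -mulrA -(V_basis R ((s ^ n)%N%:Z * l)) 1?ltnW//.
apply/funext => k; rewrite [RHS](_ : _ = c * V s (basis_vec R ((s ^ n)%N%:Z * l)) k)//.
by rewrite /V; case: ifP => // _; rewrite mulr0.
Qed.

Lemma coords_ebasis l : coords (ebasis R l) = basis_vec R l.
Proof. by apply/funext => k; rewrite ebasisE. Qed.

Lemma fct_sumE (I : Type) (r : seq I) (g : I -> int -> R[i]) j :
  (\sum_(n <- r) g n) j = \sum_(n <- r) g n j.
Proof. by elim: r => [|n r IHr]; rewrite ?big_nil// !big_cons -IHr. Qed.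

Lemma psumE F N x k :
  psum s F N x k = \sum_(n < N) iter n (V s) (Mop s (F n%:Z) x) k.
Proof. exact: fct_sumE. Qed.

(** The n-th summand sends E_l to a multiple of E_(s^n l), so only n = v(k) - v(l) can contribute to
    the (k, l) entry. *)
Lemma psum_ent F N k l : psum s F N (ebasis R l) k =
  if (v l <= v k)%N && (v k - v l < N)%N then dmx F k l else 0.
Proof.
rewrite psumE coords_ebasis.
have [->|l0] := eqVneq l 0.
  rewrite /dmx eqxx /= andbF if_same big1// => n _.
  rewrite (_ : Mop _ _ _ = 0 *: basis_vec R 0).
    by rewrite V_basisZ scale0r.
  apply/funext => j; rewrite scale0r /Mop /basis_vec; case: ifP => // ->.
  by rewrite mulr0.
have termE (n : 'I_N) : iter n (V s) (Mop s (F n%:Z) (basis_vec R l)) k =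
    F n%:Z (v l, digits s (sp l)) * (k == (s ^ n)%N%:Z * l)%:R.
  rewrite (_ : Mop _ _ _ = F n%:Z (v l, digits s (sp l)) *: basis_vec R l).
    by rewrite V_basisZ.
  apply/funext => j; rewrite [RHS](_ : _ = F n%:Z (v l, digits s (sp l)) * (j == l)%:R)//.
  rewrite /Mop /basis_vec; case: eqP => [j0|_]; case: eqP => [jl|_]; rewrite ?mulr0//.
    by rewrite -jl j0 eqxx in l0.
  by rewrite jl.
rewrite (eq_bigr _ (fun n _ => termE n)).
have kE (n : nat) : k == (s ^ n)%N%:Z * l ->
    [/\ k != 0, sp k = sp l, (v l <= v k)%N & n = (v k - v l)%N].
  move=> /eqP ->; have [-> ->] := sadic_exp_mul hs n l0.
  by split; rewrite ?mulf_neq0 ?expz_neq0 ?leq_addl ?addnK.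
case: ifPn => [/andP[lk kN]|nlk]; last first.
  rewrite big1// => n _; case: eqP => [/eqP/kE[_ _ lk nE]|_]; last by rewrite mulr0.
  by case/negP: nlk; rewrite lk -nE ltn_ord.
rewrite /dmx l0/=; case: ifPn => [/andP[k0 /eqP kl]|nkl]; last first.
  rewrite big1// => n _; case: eqP => [/eqP/kE[k0 kl _ _]|_]; last by rewrite mulr0.
  by case/negP: nkl; rewrite k0 kl/=.
rewrite (bigD1 (Ordinal kN))//= -(sadic_ratio kl lk) eqxx mulr1 big1.
  by rewrite addr0 subzn// (minn_idPr lk) kl.
move=> n nN; case: eqP => [/eqP/kE[_ _ _ nE]|_]; last by rewrite mulr0.
by case/eqP: nN; apply: val_inj.
Qed.

Lemma iter_Vadj n y k : iter n (Vadj s) y k = y ((s ^ n)%N%:Z * k).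
Proof.
elim: n k => [|n IHn] k; first by rewrite expn0 mul1r.
by rewrite iterS /Vadj IHn expnSr PoszM mulrA.
Qed.

Lemma nsumE F N x k : nsum s F N x k = \sum_(n < N)
  Mop s (F (- n.+1%:Z)) (iter n.+1 (Vadj s) x) k.
Proof. exact: fct_sumE. Qed.

(** The summand of index n carries the exponent n + 1. Hence the diagonal k / l = 1 is excluded and
    the cutoff reads [<= N], against [< N] for [psum]. *)
Lemma nsum_ent F N k l : nsum s F N (ebasis R l) k =
  if (v k < v l)%N && (v l - v k <= N)%N then dmx F k l else 0.
Proof.
rewrite nsumE coords_ebasis.
have [->|k0] := eqVneq k 0.
  by rewrite /dmx eqxx if_same big1// => n _; rewrite /Mop eqxx.
have termE (n : 'I_N) :
    Mop s (F (- n.+1%:Z)) (iter n.+1 (Vadj s) (basis_vec R l)) k =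
    F (- n.+1%:Z) (v k, digits s (sp k)) * (l == (s ^ n.+1)%N%:Z * k)%:R.
  by rewrite /Mop (negbTE k0) iter_Vadj /basis_vec eq_sym.
rewrite (eq_bigr _ (fun n _ => termE n)).
have lE (n : nat) : l == (s ^ n)%N%:Z * k ->
    [/\ l != 0, sp k = sp l, (v k <= v l)%N & n = (v l - v k)%N].
  move=> /eqP ->; have [-> ->] := sadic_exp_mul hs n k0.
  by split; rewrite ?mulf_neq0 ?expz_neq0 ?leq_addl ?addnK.
case: ifPn => [/andP[kl lN]|nkl]; last first.
  rewrite big1// => n _; case: eqP => [/eqP/lE[_ _ kl nE]|_]; last by rewrite mulr0.
  case/negP: nkl; rewrite -nE ltn_ord andbT -subn_gt0 -nE//.
rewrite /dmx k0/=; case: ifPn => [/andP[l0 /eqP skl]|nskl]; last first.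
  rewrite big1// => n _; case: eqP => [/eqP/lE[l0 skl _ _]|_]; last by rewrite mulr0.
  by case/negP: nskl; rewrite l0 skl/=.
have lN' : ((v l - v k).-1 < N)%N by rewrite prednK// subn_gt0.
have pE : (v l - v k).-1.+1 = (v l - v k)%N by rewrite prednK// subn_gt0.
rewrite (bigD1 (Ordinal lN'))//= pE -(sadic_ratio (esym skl) (ltnW kl)) eqxx mulr1 big1.
  by rewrite addr0 -subzn 1?ltnW// opprB (minn_idPl (ltnW kl)).
move=> n nN; case: eqP => [/eqP/lE[_ _ _ nE]|_]; last by rewrite mulr0.
by case/eqP: nN; apply: val_inj; rewrite /= -nE.
Qed.

Lemma Mop_lin f (c : R[i]) y y' :
  Mop s f (c *: y + y') = c *: Mop s f y + Mop s f y'.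
Proof.
apply/funext => k; rewrite [RHS](_ : _ = c * Mop s f y k + Mop s f y' k)//.
rewrite /Mop; case: ifP => _; first by rewrite mulr0 addr0.
by rewrite [LHS](_ : _ = f (v k, digits s (sp k)) * (c * y k + y' k))// mulrDr mulrCA.
Qed.

Lemma iter_Vadj_lin n (c : R[i]) y y' : iter n (Vadj s) (c *: y + y') =
  c *: iter n (Vadj s) y + iter n (Vadj s) y'.
Proof.
apply/funext => k.
rewrite [RHS](_ : _ = c * iter n (Vadj s) y k + iter n (Vadj s) y' k)//.
by rewrite !iter_Vadj.
Qed.

Lemma psum_lin F N : lin (psum s F N).
Proof.
move=> c x x'; rewrite /psum scaler_sumr -big_split; apply: eq_bigr => n _ /=.
by rewrite Mop_lin iterVD.
Qed.

Lemma nsum_lin F N : lin (nsum s F N).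
Proof.
move=> c x x'; rewrite /nsum scaler_sumr -big_split; apply: eq_bigr => n _.
by rewrite iter_Vadj_lin Mop_lin.
Qed.

(** [V] reads the coordinate k / s, never one of larger absolute value. *)
Lemma psum_local F N x x' k : (forall j : int, (`|j| <= `|k|)%N -> x j = x' j) ->
  psum s F N x k = psum s F N x' k.
Proof.
have V_local n y y' : (forall j : int, (`|j| <= `|k|)%N -> y j = y' j) ->
    forall j : int, (`|j| <= `|k|)%N -> iter n (V s) y j = iter n (V s) y' j.
  move=> yy; elim: n => [//|n IHn] j jk; rewrite !iterS /V; case: ifP => // /dvdzP[q qE].
  apply: IHn; apply: leq_trans jk; rewrite qE mulzK; last first.
    by rewrite eqz_nat -lt0n ltnW.
  by rewrite abszM absz_nat leq_pmulr// ltnW.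
move=> xx; rewrite !psumE; apply: eq_bigr => n _.
by apply: V_local => // j jk; rewrite /Mop xx.
Qed.

(** The cutoff may vary with the row: row k of the whole series over n >= 0 is already that of its
    first v(k) + 1 terms. *)
Lemma psum_trunc_cont F (N : int -> nat) :
  trunc_cont (fun x k => psum s F (N k) x k).
Proof.
move=> x k; apply: (@ccvg_near _ _ _ `|k|%N) => n kn; apply: psum_local => j jk.
by rewrite truncE (leq_trans jk kn).
Qed.

Lemma nsum_trunc_cont F N : trunc_cont (nsum s F N).
Proof.
move=> x k; apply: (@ccvg_near _ _ _ (s ^ N * `|k|)%N) => m km.
rewrite !nsumE; apply: eq_bigr => n _; rewrite /Mop; case: ifP => // _.
rewrite !iter_Vadj truncE (leq_trans _ km)//.
by rewrite abszM absz_nat leq_mul2r leq_exp2l// ltn_ord orbT.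
Qed.

(** The distance |v(k) - v(l)|: one of the two truncated differences is 0. *)
Definition dst k l : nat := ((v k - v l) + (v l - v k))%N.

Lemma dst_ratio k l : sp k = sp l ->
  k = (s ^ dst k l)%N%:Z * l \/ l = (s ^ dst k l)%N%:Z * k.
Proof.
move=> kl; rewrite /dst; case: (leqP (v l) (v k)) => [lk|/ltnW lk].
  by left; move: (lk); rewrite -subn_eq0 => /eqP ->; rewrite addn0; exact: sadic_ratio.
right; move: (lk); rewrite -subn_eq0 => /eqP ->; rewrite add0n.
exact: sadic_ratio.
Qed.

Lemma sum_telescope N0 n :
  \sum_(i < n) (((N0 + i).+1%:R * (N0 + i).+2%:R)^-1 : R) <= N0.+1%:R^-1.
Proof.
suff -> : \sum_(i < n) (((N0 + i).+1%:R * (N0 + i).+2%:R)^-1 : R) =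
    N0.+1%:R^-1 - (N0 + n).+1%:R^-1.
  by rewrite lerBlDr lerDl invr_ge0.
elim: n => [|n IHn]; first by rewrite big_ord0 addn0 subrr.
rewrite big_ord_recr/= IHn addnS.
have a0 : (N0 + n).+1%:R != 0 :> R by rewrite pnatr_eq0.
have b0 : (N0 + n).+2%:R != 0 :> R by rewrite pnatr_eq0.
have -> : (N0 + n).+2%:R = (N0 + n).+1%:R + 1 :> R by rewrite -natr1.
rewrite -natr1 in b0; move: (_.+1%:R) (_.+1%:R^-1) a0 b0 => p q p0 p1.
by field; rewrite p0 p1.
Qed.

(* The weights (n + 1) (n + 2) make the tails of the sums over the diagonals
   n >= N0 telescope to 1 / (N0 + 1). *)
Definition on_diagonals N0 (c : R) (A : int -> int -> R[i]) := forall k l,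
  A k l != 0 -> [/\ k != 0, l != 0, sp k = sp l, (N0 <= dst k l)%N &
    normc (A k l) * ((dst k l).+1%:R * (dst k l).+2%:R) <= c].

(** At distance d from the main diagonal, row k meets at most the two columns k / s^d and s^d k.
    This explains the factor 2; the weights then telescope. *)
Lemma row_sum_on_diagonals N0 c A k n : 0 <= c -> on_diagonals N0 c A ->
  \sum_(l <- zr n) normc (A k l) <= 2 * c / N0.+1%:R.
Proof.
(* [D] exceeds every distance d that occurs: d < s^d, and s^d is at most |k| or at most |l| <= n. *)
move=> c0 Ac; pose D := (`|k| + n)%N.
pose g (i : nat) : R := ((N0 + i).+1%:R * (N0 + i).+2%:R)^-1.
have g0 i : 0 <= g i by rewrite invr_ge0 mulr_ge0.
apply: (@le_trans _ _ (\sum_(l <- zr n) \sum_(i < D)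
    c * g i * ((k == (s ^ (N0 + i))%N%:Z * l)%:R + (l == (s ^ (N0 + i))%N%:Z * k)%:R))).
  rewrite big_seq [leRHS]big_seq; apply: ler_sum => l; rewrite mem_zr => ln.
  have t0 i : 0 <= c * g i *
      ((k == (s ^ (N0 + i))%N%:Z * l)%:R + (l == (s ^ (N0 + i))%N%:Z * k)%:R) :> R.
    by rewrite !mulr_ge0// addr_ge0.
  have [->|/Ac[k0 l0 kl Nd Ad]] := eqVneq (A k l) 0.
    by rewrite normc0; apply: sumr_ge0 => i _.
  have dD : (dst k l < D)%N.
    apply: leq_trans (ltn_expl _ hs) _; rewrite /D.
    have [E|E] := dst_ratio kl.
      apply: leq_trans (leq_addr _ _).
      by rewrite {2}E abszM absz_nat leq_pmulr// absz_gt0.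
    apply: leq_trans (leq_addl _ _); apply: leq_trans ln.
    by rewrite {2}E abszM absz_nat leq_pmulr// absz_gt0.
  have iD : (dst k l - N0 < D)%N by apply: leq_ltn_trans dD; exact: leq_subr.
  rewrite (bigD1 (Ordinal iD))//= subnKC//.
  apply: le_trans (_ : c * g (dst k l - N0)%N <= _).
    by rewrite /g subnKC// ler_pdivlMr// mulr_gt0.
  rewrite -[leLHS]addr0; apply: lerD; last exact: sumr_ge0.
  rewrite -[leLHS]mulr1; apply: ler_wpM2l; first by rewrite mulr_ge0.
  have [/eqP E|/eqP E] := dst_ratio kl; first by rewrite E lerDl.
  by rewrite E lerDr.
rewrite exchange_big/=.
apply: (@le_trans _ _ (\sum_(i < D) 2 * c * g i)).
  apply: ler_sum => i _; rewrite -mulr_sumr [2 * c]mulrC -!mulrA [2 * _]mulrC !mulrA.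
  apply: ler_wpM2l; first by rewrite mulr_ge0.
  rewrite big_split/= -[leRHS]/(1 + 1); apply: lerD.
    rewrite (big_zr_pick _ (l := (k %/ (s ^ (N0 + i))%N%:Z)%Z)).
      by case: ifP => //; case: eqP.
    move=> l lk; rewrite (_ : (k == _) = false)//; apply: contraNF lk => /eqP ->.
    by rewrite mulrC mulzK ?expz_neq0.
  rewrite (big_zr_pick _ (l := (s ^ (N0 + i))%N%:Z * k)).
    by case: ifP => //; case: eqP.
  by move=> l /negbTE ->.
rewrite -mulr_sumr; apply: ler_wpM2l; first by rewrite mulr_ge0.
exact: sum_telescope.
Qed.

Lemma mxnorm_on_diagonals N0 c A : 0 <= c -> on_diagonals N0 c A ->
  (mxnorm A <= (2 * c / N0.+1%:R)%:E)%E.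
Proof.
move=> c0 Ac; apply: mxnorm_schur.
- by rewrite divr_ge0 ?mulr_ge0.
- by move=> k n; exact: row_sum_on_diagonals.
- move=> l n; apply: (@row_sum_on_diagonals _ _ (fun l k => A k l)) => // k' l' A0.
  have [? ? skl Nd Ad] := Ac _ _ A0.
  by rewrite [dst _ _]addnC.
Qed.

End DiagonalMatrices.

(** * From matrices to operators *)

Section OperatorConvergence.
Variables (R : realType).
Local Notation H := (ell2 R).
Implicit Types (a b : bop R) (T : H -> int -> R[i]).

(** Boundedness forces the values of T, a priori arbitrary families, into l^2. *)
Lemma mk_bop T (c : R) : 0 <= c -> lin T -> (opnorm setT T <= c%:E)%E ->
  exists a, act a = T.
Proof.
move=> c0 lT Tc; have Tx x : (l2norm (T x) <= c%:E * l2norm x)%E.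
  by apply: opnorm_bound Tc _ => //; exact: lin_homog.
have sT x : square_summable (T x).
  apply: le_lt_trans (Tx x) _; apply: lte_mul_pinfty => //.
  by rewrite -ge0_fin_numE ?l2norm_ge0 ?ell2_fin.
have bT : bounded_linear (fun x => Ell2 (sT x)).
  apply/asboolP; split; last exact: le_lt_trans Tc (ltry _).
  by move=> d x y; apply: val_inj => /=; rewrite lT.
by exists (Bop bT).
Qed.

Lemma opcvgP (S : nat -> H -> int -> R[i]) a : opcvg S a <->
  forall e : R, 0 < e -> exists N, forall n, (N <= n)%N ->
    (opnorm setT (act a - S n)%R <= e%:E)%E.
Proof.
have on0 n : (0 <= opnorm setT (act a - S n)%R)%E by exact: opnorm_ge0.
split=> [/fine_cvgP[[N1 _ fS] /cvgrPdist_lt cS] e e0|cS].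
  have [N2 _ eS] := cS _ e0; exists (maxn N1 N2) => n; rewrite geq_max => /andP[n1 n2].
  have fn := fS _ n1; have := eS _ n2; rewrite /= sub0r normrN.
  by rewrite ger0_norm ?fine_ge0// -lte_fin fineK// => /ltW.
apply/fine_cvgP; split.
  have [N NS] := cS 1 ltr01; exists N => // n /= /NS n1.
  by rewrite ge0_fin_numE// (le_lt_trans n1)// ltry.
apply/cvgrPdist_le => e /cS[N NS]; exists N => // n /= /NS ne.
rewrite sub0r normrN ger0_norm ?fine_ge0// -lee_fin fineK//.
by rewrite ge0_fin_numE// (le_lt_trans ne)// ltry.
Qed.

Lemma opcvg_ent (S : nat -> H -> int -> R[i]) a k l :
  opcvg S a -> ccvg (fun n => S n (ebasis R l) k) (ent a k l).
Proof.
move=> /opcvgP Sa; apply/ccvgP => e e0.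
have e20 : 0 < e / 2 by rewrite divr_gt0.
have [N NS] := Sa _ e20; exists N => n /NS Se.
rewrite normcB; apply: (@le_lt_trans _ _ (e / 2)); last by lra.
rewrite -lee_fin; apply: le_trans Se.
apply: le_trans (normc_le_l2norm (act a (ebasis R l) - S n (ebasis R l)) k) _.
exact: (opnorm_ub (act a - S n) I (l2norm_ebasis _ _)).
Qed.

Lemma opnorm_ent a : opnorm setT (act a) = mxnorm (ent a).
Proof.
by rewrite opnorm_trunc_cont; [exact/is_mx_norm/bop_is_mx|exact: bop_trunc_cont].
Qed.

Lemma inv_succ_lt (c e : R) : 0 < e -> exists N, forall n, (N <= n)%N ->
  c / n.+1%:R <= e.
Proof.
move=> e0; have c10 : 0 < `|c| + 1 by rewrite ltr_wpDl.
have [N _ NP] := near_infty_natSinv_lt (PosNum (divr_gt0 e0 c10)).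
exists N => n /NP /=; rewrite ltr_pdivlMr// => h.
apply: le_trans (ltW h); rewrite mulrC; apply: ler_wpM2l.
  by rewrite invr_ge0.
by apply: le_trans (ler_norm c) _; rewrite lerDl.
Qed.

Lemma opcvg_inv_succ (S : nat -> H -> int -> R[i]) a c :
  (forall n, (opnorm setT (act a - S n)%R <= (c / n.+1%:R)%:E)%E) -> opcvg S a.
Proof.
move=> Sa; apply/opcvgP => e /(inv_succ_lt c)[N NP]; exists N => n /NP h.
by apply: le_trans (Sa n) _; rewrite lee_fin.
Qed.

End OperatorConvergence.

(** * Passing between elements of I_s^oo and their entries *)

Section SmoothMatrices.
Variables (R : realType) (s : nat).
Hypothesis hs : (1 < s)%N.
Local Notation H := (ell2 R).
Local Notation v := (sadic_val s).
Local Notation sp := (spart s).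
Local Notation X := (nat * {ptws nat -> nat})%type.
Implicit Types (F : int -> X -> R[i]) (a b : bop R) (x : H).

(** Norm convergence implies convergence of entries. Those of the partial sums are eventually
    constant, and each position receives its value from one of the two series only. *)
Lemma Isoo_ent F a b c :
  opcvg (psum s F) b -> opcvg (nsum s F) c -> a = b + c ->
  forall k l, ent a k l = dmx s F k l.
Proof.
move=> Fb Fc -> k l; rewrite [LHS](_ : _ = ent b k l + ent c k l)//.
have bkl := opcvg_ent k l Fb; have ckl := opcvg_ent k l Fc.
case: (leqP (v l) (v k)) => lk.
  rewrite (ccvg_uniq bkl (w := dmx s F k l)); last first.
    by apply: (@ccvg_near _ _ _ (v k - v l).+1) => n nk; rewrite psum_ent// lk nk.
  rewrite (ccvg_uniq ckl (w := 0)) ?addr0//.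
  by apply: (@ccvg_near _ _ _ 0%N) => n _; rewrite nsum_ent// ltnNge lk.
rewrite (ccvg_uniq bkl (w := 0)) ?add0r; last first.
  by apply: (@ccvg_near _ _ _ 0%N) => n _; rewrite psum_ent// leqNgt lk.
apply: (ccvg_uniq ckl).
by apply: (@ccvg_near _ _ _ (v l - v k)) => n nk; rewrite nsum_ent// lk nk.
Qed.

Lemma absz_dst k l : (`|(v k)%:Z - (v l)%:Z| = dst s k l)%N.
Proof. by rewrite /dst; lia. Qed.

(** At the entry (k, l) one has n = v(k) - v(l) and m = min(v(k), v(l)), so 1 + m + |n| = 1 +
    max(v(k), v(l)). *)
Lemma dmx_decay F : rapid_decay (fun n m => supZs s (F n) m) ->
  forall K : nat, exists2 c : R, 0 <= c & forall k l,
    (1 + maxn (v k) (v l))%N%:R ^+ K * normc (dmx s F k l) <= c.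
Proof.
move=> /rapid_decayP rd K; have [c c0 Fc] := rd K; exists c => // k l.
rewrite /dmx; case: ifPn => [/and3P[k0 l0 /eqP kl]|_]; last by rewrite normc0 mulr0.
have := Fc ((v k)%:Z - (v l)%:Z) (minn (v k) (v l)) (digits s (sp k))
  (digits_units (ltnW hs) (spart_ndvd hs k0)).
rewrite natrX absz_dst (_ : 1 + minn _ _ + _ = 1 + maxn (v k) (v l))%N//.
by rewrite /dst; lia.
Qed.

Lemma dst_lt k l : (dst s k l < 1 + maxn (v k) (v l))%N.
Proof. by rewrite /dst; lia. Qed.

Lemma normc_dst k l : normc ((v k)%:R - (v l)%:R : R[i]) = (dst s k l)%:R.
Proof.
rewrite /dst; case: (leqP (v l) (v k)) => [lk|/ltnW lk].
  by rewrite -natrB// normc_nat; move: (lk); rewrite -subn_eq0 => /eqP ->; rewrite addn0.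
by rewrite normcB -natrB// normc_nat; move: (lk); rewrite -subn_eq0 => /eqP ->.
Qed.

(** [g] holds the factors coming from derivatives and weights; [P] selects the part of the matrix to
    estimate, for instance the tail of a series. *)
Lemma dmx_on_diagonals F N0 (c : R) (P : int -> int -> bool) (g : int -> int -> R[i]) :
  0 <= c ->
  (forall k l, (1 + maxn (v k) (v l))%N%:R ^+ 2 * normc (g k l * dmx s F k l) <= c) ->
  (forall k l, P k l -> (N0 <= dst s k l)%N) ->
  on_diagonals s N0 (2 * c) (fun k l => if P k l then g k l * dmx s F k l else 0).
Proof.
move=> c0 Fc PN k l; case: ifP => [kl|]; last by rewrite eqxx.
rewrite mulf_eq0 negb_or => /andP[_]; have := Fc k l.
rewrite {2}/dmx; case: ifPn => [/and3P[k0 l0 /eqP skl] Fkl _|]; last by rewrite eqxx.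
split=> //; first exact: PN.
have nn : 0 <= normc (g k l * dmx s F k l) by exact: normc_ge0.
(* With d the distance, (d + 1) (d + 2) <= 2 (d + 1)^2, and d + 1 is at most 1 + max(v(k), v(l)). *)
apply: (@le_trans _ _ (2 * ((1 + maxn (v k) (v l))%N%:R ^+ 2 *
    normc (g k l * dmx s F k l)))); last first.
  apply: ler_wpM2l => //; apply: le_trans (Fc k l); apply: lexx.
rewrite [leLHS]mulrC [leRHS]mulrA; apply: ler_wpM2r => //.
have : (dst s k l).+1%:R <= (1 + maxn (v k) (v l))%N%:R :> R.
  by rewrite ler_nat dst_lt.
have : 1 <= (dst s k l).+1%:R :> R by rewrite ler1n.
rewrite -[(dst s k l).+2%:R]natr1; move: (dst s k l).+1%:R (1 + _)%N%:R => p q.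
by rewrite expr2 => p1 pq; nra.
Qed.

Lemma Isoo_mxnorm F a j N : rapid_decay (fun n m => supZs s (F n) m) ->
  (forall k l, ent a k l = dmx s F k l) ->
  (mxnorm (weightmx s N (derivmx s j (ent a))) < +oo)%E.
Proof.
(* The powers [j] and [N] absorb the derivatives and the weight; the remaining 2 makes the sum over
   the diagonals converge. *)
move=> Frd aF; have [c c0 Fc] := dmx_decay Frd (j + N + 2).
pose g k l : R[i] := ((v k)%:R - (v l)%:R) ^+ j * (1 + (v l)%:R) ^+ N.
have := @dmx_on_diagonals F 0 c (fun _ _ => true) g c0 _ (fun _ _ _ => leq0n _).
move=> /(_ _)/mxnorm_on_diagonals h.
apply: (@le_lt_trans _ _ (2 * (2 * c) / 1)%:E); last exact: ltry.
rewrite (@eq_mxnorm _ _ (fun k l => g k l * dmx s F k l)).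
  apply: h => // [|k l]; first by rewrite mulr_ge0.
  apply: le_trans (Fc k l); rewrite normcM mulrA; apply: ler_wpM2r; first exact: normc_ge0.
  set p := (1 + maxn _ _)%N%:R.
  rewrite exprD mulrC; apply: ler_wpM2r; first by rewrite exprn_ge0.
  rewrite /g normcM !normcX exprD; apply: ler_pM; rewrite ?exprn_ge0 ?normc_ge0//.
    rewrite lerXn2r ?nnegrE ?normc_ge0//.
    by rewrite normc_dst ler_nat ltnW// dst_lt.
  rewrite lerXn2r ?nnegrE ?normc_ge0// -(natrD _ 1) normc_nat ler_nat leq_add2l.
  exact: leq_maxr.
by move=> k l; rewrite /weightmx /derivmx aF /g mulrAC.
Qed.

(** The remainders of the two series are supported at distance at least N from the main diagonal, so
    their norms are at most a constant over N + 1 and both series converge in norm. *)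
Lemma Isoo_of_ent F a :
  (forall n, C0 ([set: nat] `*` Zs_units s) (F n)) ->
  rapid_decay (fun n m => supZs s (F n) m) ->
  (forall k l, ent a k l = dmx s F k l) -> Isoo_pred s a.
Proof.
move=> FC0 Frd aF; have [c c0 Fc] := dmx_decay Frd 2.
(* The sum of the series over n >= 0, written without a limit: in row k the terms with n > v(k)
   vanish. *)
pose T x k := psum s F (v k).+1 x k.
have Tlin : lin T.
  move=> e x x'; apply/funext => k; rewrite /T psum_lin.
  by [].
have Tent k l : T (ebasis R l) k = if (v l <= v k)%N then dmx s F k l else 0.
  by rewrite /T psum_ent// ltnS leq_subr andbT.
have Ttc : trunc_cont T by apply: psum_trunc_cont.
have diag N0 (P : int -> int -> bool) (A : int -> int -> R[i]) :
    (forall k l, P k l -> (N0 <= dst s k l)%N) ->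
    (forall k l, A k l = if P k l then dmx s F k l else 0) ->
    (mxnorm A <= (2 * (2 * c) / N0.+1%:R)%:E)%E.
  move=> PN AE; apply: (@mxnorm_on_diagonals _ _ hs); first by rewrite mulr_ge0.
  rewrite (_ : A = fun k l => if P k l then 1 * dmx s F k l else 0).
    by apply: (@dmx_on_diagonals F N0 c P (fun _ _ => 1)) => // k l; rewrite mul1r.
  by apply/funext => k; apply/funext => l; rewrite AE mul1r.
have C0 : 0 <= 2 * (2 * c) / 1 by rewrite divr1 !mulr_ge0.
have [b bT] : exists b, act b = T.
  apply: (mk_bop C0 Tlin); rewrite opnorm_trunc_cont// (is_mx_norm (lin_is_mx Tlin)).
  exact: (diag 0%N (fun k l => v l <= v k)%N).
have bE k l : ent b k l = if (v l <= v k)%N then dmx s F k l else 0.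
  by rewrite /ent bT Tent.
have sub (a' : bop R) (S : H -> int -> R[i]) (N0 : nat) : lin S -> trunc_cont S ->
    (mxnorm (fun k l => ent a' k l - S (ebasis R l) k)%R
      <= (2 * (2 * c) / N0.+1%:R)%:E)%E ->
    (opnorm setT (act a' - S)%R <= (2 * (2 * c) / N0.+1%:R)%:E)%E.
  move=> Sl Stc h; rewrite opnorm_trunc_cont; last first.
    by apply: trunc_contB => //; exact: bop_trunc_cont.
  have Dl : lin (act a' - S).
    move=> e x x'; rewrite -[LHS]/(act a' (e *: x + x') - S (e *: x + x')).
    rewrite bop_lin Sl -[RHS]/(e *: (act a' x - S x) + (act a' x' - S x')).
    by rewrite scalerBr opprD addrACA.
  by rewrite (is_mx_norm (lin_is_mx Dl)); exact: h.
(* Only the nonnegative part [b] had to be constructed; the negative part is [a - b]. *)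
exists F; split => //; exists b, (a - b); split; last by rewrite addrCA subrr addr0.
- apply: (@opcvg_inv_succ _ _ _ (2 * (2 * c))) => N.
  apply: sub; [exact: psum_lin|exact: psum_trunc_cont|].
  apply: (diag N (fun k l => (v l <= v k) && (N <= v k - v l))%N).
    by move=> k l; rewrite /dst; lia.
  move=> k l; rewrite bE psum_ent//; case: (leqP (v l) (v k)) => /= _; rewrite ?subrr//.
  by case: (ltnP (v k - v l) N) => _; rewrite ?subr0 ?subrr.
- apply: (@opcvg_inv_succ _ _ _ (2 * (2 * c))) => N.
  apply: sub; [exact: nsum_lin|exact: nsum_trunc_cont|].
  apply: (diag N (fun k l => (v k < v l) && (N < v l - v k))%N).
    by move=> k l; rewrite /dst; lia.
  move=> k l; rewrite [ent (a - b) k l](_ : _ = ent a k l - ent b k l)//.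
  rewrite aF bE nsum_ent//; case: (leqP (v l) (v k)) => /= _; rewrite ?subrr ?subr0//.
  by case: (leqP (v l - v k) N) => _; rewrite ?subr0 ?subrr.
Qed.

End SmoothMatrices.

(** * The characterization of I_s^oo by its norms *)

Section UniformLimits.
Variable R : realType.

Lemma lt_normc (z : R[i]) (e : R) : (`|z| < (e%:C)%C) = (normc z < e).
Proof. by rewrite -ltcR; congr (_ < _). Qed.

(** Continuity into [R[i]] is defined with radii in [R[i]]; a positive element of [R[i]] is real, so
    real radii suffice. *)
Lemma within_normcP (Y : topologicalType) (A : set Y) (f : Y -> R[i]) :
  {within A, continuous f} <-> forall x, A x -> forall e : R, 0 < e ->
    \forall y \near within A (nbhs x), normc (f x - f y) < e.
Proof.
rewrite subspace_continuousP; split => cf x Ax.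
  move=> e e0; have /(@cvgrPdist_lt R[i] R[i]^o) := cf x Ax.
  move=> /(_ (e%:C)%C); rewrite ltcR => /(_ e0); apply: filterS => y.
  by rewrite lt_normc.
apply/(@cvgrPdist_lt R[i] R[i]^o) => e e0.
have eE : e = ((complex.Re e)%:C)%C by rewrite RRe_real// gtr0_real.
have re0 : 0 < complex.Re e by rewrite -ltcR -eE.
by apply: filterS (cf x Ax _ re0) => y; rewrite eE lt_normc.
Qed.

(** A uniform limit on A of elements of C_0(A): the compact set for d is that of a close approximant
    for d / 2. *)
Lemma C0_lim (Y : topologicalType) (A : set Y) (G : nat -> Y -> R[i])
    (f : Y -> R[i]) (e : nat -> R) :
  (forall n, C0 A (G n)) -> (forall d, 0 < d -> exists n, e n <= d) ->
  (forall n y, A y -> normc (f y - G n y) <= e n) -> C0 A f.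
Proof.
move=> GC0 e0 fG; split.
  apply/within_normcP => x Ax d d0.
  have d30 : 0 < d / 4 by rewrite divr_gt0.
  have [n nd] := e0 _ d30; have [/within_normcP cG _] := GC0 n.
  have nA : \forall y \near within A (nbhs x), A y by exact: withinT.
  apply: filterS2 (cG x Ax _ d30) nA => y Gxy Ay.
  have -> : f x - f y = (f x - G n x) + (G n x - G n y) - (f y - G n y) by ring.
  have := fG n x Ax; have := fG n y Ay.
  have := normcD (f x - G n x + (G n x - G n y)) (- (f y - G n y)).
  have := normcD (f x - G n x) (G n x - G n y).
  rewrite normcN; lra.
move=> d d0; have d20 : 0 < d / 2 by rewrite divr_gt0.
have [n nd] := e0 _ d20; have [_ G0] := GC0 n.
have [K [cK KA Kd]] := G0 _ d20; exists K; split => // y Ay nKy.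
have := fG n y Ay; have := Kd y Ay nKy; have := normcD (f y - G n y) (G n y).
by rewrite subrK; lra.
Qed.

End UniformLimits.

(** * Density in the units of the integers not divisible by s *)

Section IntegersAreDense.
Variables (R : realType) (s : nat).
Hypothesis hs : (1 < s)%N.
Local Notation X := (nat * {ptws nat -> nat})%type.

Definition digit_sum (x : nat -> nat) (n : nat) : nat := \sum_(i < n) x i * s ^ i.

Lemma digit_sum_lt x n : (forall i, x i < s)%N -> (digit_sum x n < s ^ n)%N.
Proof.
move=> xs; elim: n => [|n IHn]; first by rewrite /digit_sum big_ord0.
rewrite /digit_sum big_ord_recr/= expnS.
apply: (@leq_trans ((x n).+1 * s ^ n)); last by rewrite leq_mul2r xs orbT.
by rewrite mulSn ltn_add2r.
Qed.

Lemma digit_sum_digit x n i : (forall i, x i < s)%N -> (i < n)%N ->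
  ((digit_sum x n %/ s ^ i) %% s = x i)%N.
Proof.
move=> xs; have s0 j : (0 < s ^ j)%N by rewrite expn_gt0 ltnW.
elim: n => [//|n IHn]; rewrite ltnS leq_eqVlt => /predU1P[->|ni].
  rewrite /digit_sum big_ord_recr/= addnC divnMDl// divn_small ?addn0 ?modn_small//.
  exact: digit_sum_lt.
rewrite -[RHS]IHn// {1}/digit_sum big_ord_recr/= addnC.
rewrite -{2}(subnK (ltnW ni)) expnD mulnA divnMDl//.
by rewrite -(subnSK ni) expnSr mulnA modnMDl.
Qed.

Lemma digits_digit_sum x n i : (forall i, x i < s)%N -> (i < n)%N ->
  digits s (digit_sum x n)%:Z i = x i.
Proof.
by move=> xs ni; rewrite /digits divz_nat modz_nat absz_nat digit_sum_digit.
Qed.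

Lemma digit_sum_ndvd x n : (forall i, x i < s)%N -> x 0%N != 0%N ->
  ~~ (s%:Z %| (digit_sum x n.+1)%:Z)%Z.
Proof.
move=> xs; apply: contraNN; rewrite dvdzE !absz_nat /dvdn => /eqP h.
by have := digit_sum_digit xs (ltn0Sn n); rewrite expn0 divn1 h => <-.
Qed.

Lemma cvg_digit_sum (x : {ptws nat -> nat}) : Zs s x ->
  (digits s (digit_sum x n.+1)%:Z : {ptws nat -> nat}) @[n --> \oo] --> x.
Proof.
move=> xs; apply/pointwise_cvgP => i.
apply: cvg_near_cst; exists i => // n /= ni.
by rewrite digits_digit_sum.
Qed.

(** The integers formed by the first digits of x converge to x, and continuity carries the bound
    along. Estimates on entries, which see only integers, thus reach all of the units. *)
Lemma le_on_units (f : X -> R[i]) (m : nat) (c : R) (x : {ptws nat -> nat}) :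
  {within [set: nat] `*` Zs_units s, continuous f} ->
  (forall q, ~~ (s%:Z %| q)%Z -> normc (f (m, digits s q)) <= c) ->
  Zs_units s x -> normc (f (m, x)) <= c.
Proof.
(* At least one digit is kept, so that x_0 != 0 prevents [s] from dividing the integer. *)
move=> cf fc [xs x0]; pose q n := (digit_sum x n.+1)%:Z.
have sq n : ~~ (s%:Z %| q n)%Z by exact: digit_sum_ndvd.
have qc : (m, digits s (q n) : {ptws nat -> nat}) @[n --> \oo] -->
    within ([set: nat] `*` Zs_units s) (nbhs ((m, x) : X)).
  have qc' : ((m, digits s (q n)) : X) @[n --> \oo] --> ((m, x) : X).
    by apply: (@cvg_pair _ _ _ _ (nbhs m) (nbhs x)); [exact: cvg_cst|exact: cvg_digit_sum].
  move=> P /qc'; rewrite /= /nbhs/= => h; apply: filterS h => n; apply.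
  exact: (conj I (digits_units (ltnW hs) (sq n))).
apply: (@ccvg_normc_le _ (fun n => f (m, digits s (q n))) _ _ 0%N) => [|n _]; last exact: fc.
apply/ccvgP => e e0.
have := proj1 (within_normcP _ _) cf (m, x) (conj I (conj xs x0)) e e0.
by move=> /qc [N _ NP]; exists N => n /NP /=; rewrite normcB.
Qed.

End IntegersAreDense.

(** * Recovering the functions F_n from an operator with finite norms *)

Section SmoothCharacterization.
Variables (R : realType) (s : nat).
Hypothesis hs : (1 < s)%N.
Local Notation v := (sadic_val s).
Local Notation sp := (spart s).
Local Notation X := (nat * {ptws nat -> nat})%type.
Implicit Types (F : int -> X -> R[i]) (a b : bop R).

(** Every value of F_n at an integer not divisible by [s] is an entry, at k = s^i q and l = s^j q
    with i - j = n and min(i, j) = m. *)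
Lemma dmx_at (n : int) (m : nat) (q : int) : ~~ (s%:Z %| q)%Z ->
  exists k l, [/\ (v k)%:Z - (v l)%:Z = n, minn (v k) (v l) = m &
    forall F, dmx s F k l = F n (m, digits s q)].
Proof.
move=> sq; have q0 : q != 0 by apply: contraNneq sq => ->; rewrite dvdz0.
pose i := if 0 <= n then (m + `|n|)%N else m.
pose j := if 0 <= n then m else (m + `|n|)%N.
have ij : i%:Z - j%:Z = n /\ minn i j = m by rewrite /i /j; case: ifP; lia.
exists ((s ^ i)%N%:Z * q), ((s ^ j)%N%:Z * q).
have [vi pi] := sadic_eq hs i sq; have [vj pj] := sadic_eq hs j sq.
rewrite vi vj; split; [exact: ij.1|exact: ij.2|move=> F].
by rewrite /dmx pi pj vi vj ij.1 ij.2 eqxx !mulf_neq0 ?expz_neq0.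
Qed.

Lemma normMN_term M N j a : (j <= M)%N ->
  (mxnorm (weightmx s N (derivmx s j (ent a))) <= normMN s M N (act a))%E.
Proof.
move=> jM; rewrite normMN_mx /bsum.
rewrite (bigD1 (Ordinal (n := M.+1) (m := j) jM))//= -[leLHS]adde0; apply: leeD.
  rewrite -[leLHS]mul1e; apply: lee_wpmul2r; first exact: mxnorm_ge0.
  by rewrite lee_fin ler1n bin_gt0.
by apply: sume_ge0 => i _; rewrite mule_ge0 ?lee_fin ?mxnorm_ge0.
Qed.

Lemma Isoo_pred_norms a : Isoo_pred s a ->
  forall M N, (normMN s M N (act a) < +oo)%E.
Proof.
move=> [F [_ Frd [b [c [Fb Fc abc]]]]] M N; rewrite normMN_mx.
have aF := Isoo_ent hs Fb Fc abc.
apply: lte_sum_pinfty => j _; apply: lte_mul_pinfty; rewrite ?lee_fin//.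
exact: Isoo_mxnorm Frd aF.
Qed.

Lemma Isoo_pred_Is a : Isoo_pred s a -> Is_pred s a.
Proof.
move=> aI e e0; exists a => //; rewrite subrr opnorm_ent.
by rewrite (@eq_mxnorm _ _ (fun _ _ => 0)) ?mxnorm0 ?lte_fin.
Qed.

(** For n != 0, 1 + m + |n| <= 2 |n| (1 + m). The two terms on the right are controlled by the norms
    with no derivative and with K derivatives. *)
Lemma decay_weight (K m : nat) (n : int) :
  ((1 + m + `|n|) ^ K <=
    (1 + m) ^ K + 2 ^ K * (`|n| ^ K * (1 + m) ^ K))%N.
Proof.
have [->|n0] := eqVneq n 0.
  by rewrite absz0 addn0 leq_addr.
have n1 : (0 < `|n|)%N by rewrite absz_gt0.
apply: leq_trans (leq_addl _ _); rewrite -!expnMn.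
case: K => // K; rewrite leq_exp2r//.
have := leq_pmulr 1 n1; have := leq_pmulr m n1; nia.
Qed.

Lemma Is_pred_norms_Isoo a : Is_pred s a ->
  (forall M N, (normMN s M N (act a) < +oo)%E) -> Isoo_pred s a.
Proof.
move=> aI afin; pose e (p : nat) : R := p.+1%:R^-1.
have e0 p : 0 < e p by rewrite invr_gt0.
have /choice[B BP] : forall p : nat, exists bF : bop R * (int -> X -> R[i]),
    [/\ forall n, C0 ([set: nat] `*` Zs_units s) (bF.2 n),
        forall k l, ent bF.1 k l = dmx s bF.2 k l &
        (opnorm setT (act (a - bF.1)%R) < (e p)%:E)%E].
  move=> p; have [b [F [FC0 Frd [b1 [b2 [Fb1 Fb2 bE]]]]] ab] := aI _ (e0 p).
  by exists (b, F); split => //=; exact: Isoo_ent Fb1 Fb2 bE.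
pose G p := (B p).2.
have GC0 p n : C0 ([set: nat] `*` Zs_units s) (G p n) by have [GP _ _] := BP p; exact: GP.
have aG p k l : normc (ent a k l - dmx s (G p) k l) <= e p.
  have [_ bE ab] := BP p; rewrite -lee_fin; apply/ltW; apply: le_lt_trans ab.
  rewrite opnorm_ent -bE.
  exact: (mxnorm_entry (ent (a - (B p).1)) k l).
(* At integers both functions are entries close to those of [a]; density extends the estimate to all
   units, so the approximants are uniformly Cauchy. *)
have GG p p' n m x : Zs_units s x ->
    normc (G p n (m, x) - G p' n (m, x)) <= e p + e p'.
  move=> xs; rewrite -(mulN1r (G p' n (m, x))).
  apply: (@le_on_units R s hs (fun y => G p n y + -1 * G p' n y) m) => //.
  - by case: (C0D (GC0 p n) (C0Z (-1) (GC0 p' n))).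
  - move=> q /(dmx_at n m)[k [l [_ _ E]]]; rewrite -(E (G p)) -(E (G p')) mulN1r.
    rewrite [normc _](_ : _ =
        normc ((ent a k l - dmx s (G p') k l) - (ent a k l - dmx s (G p) k l))).
      apply: le_trans (normcD _ _) _; rewrite normcN addrC.
      by apply: lerD; exact: aG.
    by congr normc; ring.
(* Nothing is asked off the units, where neither [C0] nor [supZs] looks at the values. *)
have Fex (y : int * X) : exists z, Zs_units s y.2.2 ->
    ccvg (fun p => G p y.1 y.2) z.
  case: (pselect (Zs_units s y.2.2)) => [ys|nys]; last by exists 0.
  have [z yz] : exists z, ccvg (fun p => G p y.1 y.2) z; last by exists z.
  apply: (@ccvg_cauchy _ _ (fun p => 2 * e p)).
    rewrite -(mulr0 2); apply: cvgM; [exact: cvg_cst|exact: cvg_harmonic].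
  move=> p p' pp'; case: y ys => n [m x] /= xs; apply: le_trans (GG _ _ _ _ _ xs) _.
  rewrite mulr_natl mulr2n lerD2r lef_pV2 ?posrE ?ltr0n// ler_nat.
  by rewrite ltnS.
have [F' F'P] := choice Fex; pose F n (y : X) := F' (n, y).
have Fc n m x : Zs_units s x -> ccvg (fun p => G p n (m, x)) (F n (m, x)).
  exact: (F'P (n, (m, x))).
have FG p n m x : Zs_units s x -> normc (F n (m, x) - G p n (m, x)) <= 2 * e p.
  move=> xs; apply: (@ccvg_normc_le _
    (fun p' => G p' n (m, x) + - G p n (m, x)) _ _ p).
    by apply: ccvgD (Fc _ _ _ xs) _; apply: (@ccvg_near _ _ _ 0%N).
  move=> p' pp'; apply: le_trans (GG _ _ _ _ _ xs) _.
  rewrite mulr_natl mulr2n lerD2r lef_pV2 ?posrE ?ltr0n// ler_nat.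
  by rewrite ltnS.
have aF k l : ent a k l = dmx s F k l.
  apply: (@ccvg_uniq _ (fun p => dmx s (G p) k l)).
    apply: (@ccvg_le _ _ _ e); last exact: cvg_harmonic.
    by move=> p; rewrite normcB.
  rewrite /dmx; case: ifPn => [/and3P[k0 _ _]|_]; last exact: (@ccvg_near _ _ _ 0%N).
  by apply: Fc; apply: digits_units; [exact: ltnW|exact: spart_ndvd].
have FC0 n : C0 ([set: nat] `*` Zs_units s) (F n).
  apply: (@C0_lim _ _ _ (fun p => G p n) _ (fun p => 2 * e p)) => //.
    by move=> d /(inv_succ_lt 2)[N NP]; exists N; exact: NP.
  by move=> p [m x] [_ xs]; exact: FG.
apply: (Isoo_of_ent hs FC0) => //; apply/rapid_decayP => K.
have fin j N : exists2 c : R, 0 <= c & forall k l,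
    normc (weightmx s N (derivmx s j (ent a)) k l) <= c.
  have := le_lt_trans (@normMN_term j N j a (leqnn j)) (afin j N).
  have := mxnorm_ge0 (weightmx s N (derivmx s j (ent a))).
  case E : (mxnorm _) => [c||]// c0 _; exists c => // k l.
  by rewrite -lee_fin -E mxnorm_entry.
(* The two constants bound the two terms of [decay_weight]: the weight K without derivatives, and
   the weight K with K derivatives. *)
have [c1 c10 c1P] := fin 0%N K; have [c2 c20 c2P] := fin K K.
exists (c1 + (2 ^ K)%:R * c2); first by rewrite addr_ge0 ?mulr_ge0.
move=> n m x xs; set W := _%:R.
have W0 : 0 < W by rewrite ltr0n expn_gt0.
rewrite mulrC -ler_pdivlMr//; case: (FC0 n) => cF _.
apply: (le_on_units hs cF) => // q /(dmx_at n m)[k [l [vkl mkl E]]].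
rewrite -(E F) -aF ler_pdivlMr// mulrC.
have wE j : `|n|%N%:R ^+ j * (1 + m)%N%:R ^+ K * normc (ent a k l) <=
    normc (weightmx s K (derivmx s j (ent a)) k l).
  have dE : dst s k l = `|n|%N by rewrite /dst; lia.
  rewrite /weightmx /derivmx !normcM !normcX normc_dst dE mulrAC.
  apply: ler_wpM2l; first by rewrite mulr_ge0 ?exprn_ge0 ?normc_ge0.
  rewrite -(natrD _ 1) normc_nat lerXn2r ?nnegrE// ler_nat leq_add2l -mkl.
  exact: geq_minr.
apply: (@le_trans _ _ (((1 + m) ^ K + 2 ^ K * (`|n| ^ K * (1 + m) ^ K))%N%:R *
    normc (ent a k l))).
  by apply: ler_wpM2r; rewrite ?normc_ge0// ler_nat decay_weight.
rewrite natrD mulrDl; apply: lerD.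
  by apply: le_trans (c1P k l); have := wE 0%N; rewrite expr0 mul1r natrX.
rewrite natrM -mulrA; apply: ler_wpM2l => //; apply: le_trans (c2P k l).
by have := wE K; rewrite natrM !natrX.
Qed.

End SmoothCharacterization.

(** * The topology of I_s^oo *)

Section Topology.
Variables (R : realType) (s : nat).
Hypothesis hs : (1 < s)%N.
Local Notation E := (Isoo R s).
Implicit Types (x y : E) (a b : bop R).

Lemma nbhs_isoo x (A : set E) : nbhs x A <->
  exists n, exists2 e : R, 0 < e & forall y,
    (forall M N, (M <= n)%N -> (N <= n)%N ->
      (normMN s M N (act (isoo_bop x - isoo_bop y)%R) < e%:E)%E) -> A y.
Proof.
rewrite -nbhs_entourageE; split.
  move=> [B [[n e] /= e0 eB] BA]; exists n, e => // y xy.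
  by apply: BA; apply/xsectionP; apply: eB => M N; exact: xy.
move=> [n [e e0 xA]]; exists (isoo_base (n, e)); first by exists (n, e).
by move=> y /xsectionP xy; apply: xA => M N; exact: xy.
Qed.

Lemma isoo_norm_fin x M N : (normMN s M N (act x) < +oo)%E.
Proof. by apply: Isoo_pred_norms => //; exact/asboolP/isooP. Qed.

Lemma normMN_monoM M M' N a : (M <= M')%N ->
  (normMN s M N (act a) <= normMN s M' N (act a))%E.
Proof.
elim: M' => [|M' IHM]; first by rewrite leqn0 => /eqP ->.
rewrite leq_eqVlt => /predU1P[->//|/IHM /le_trans]; apply.
by rewrite normMN_S leeDl// normMN_ge0.
Qed.

Lemma isoo_add_continuous : continuous (fun z : E * E => z.1 + z.2).
Proof.
move=> [x y] A /= /nbhs_isoo[n [e e0 xyA]].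
have e20 : 0 < e / 2 by rewrite divr_gt0.
pose U x := [set y : E | forall M N, (M <= n)%N -> (N <= n)%N ->
  (normMN s M N (act (isoo_bop x - isoo_bop y)%R) < (e / 2)%:E)%E].
have nU z : nbhs z (U z) by apply/nbhs_isoo; exists n, (e / 2).
exists (U x, U y); first by split; exact: nU.
move=> [x' y'] /= [xx yy]; apply: xyA => M N Mn Nn.
rewrite (_ : isoo_bop (x + y) - isoo_bop (x' + y') =
  (isoo_bop x - isoo_bop x') + (isoo_bop y - isoo_bop y')); last first.
  rewrite [isoo_bop (x + y)](_ : _ = isoo_bop x + isoo_bop y)//.
  rewrite [isoo_bop (x' + y')](_ : _ = isoo_bop x' + isoo_bop y')//.
  by rewrite opprD addrACA.
rewrite actD; apply: le_lt_trans (normMND _ _ _ _ _) _.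
by rewrite [e in (_ < e%:E)%E]splitr EFinD; apply: lteD; [exact: xx|exact: yy].
Qed.

Lemma isoo_scale_continuous : continuous (fun z : R[i] * E => z.1 *: z.2).
Proof.
move=> [c x] A /= /nbhs_isoo[n [e e0 cxA]].
have := isoo_norm_fin x n n; have := normMN_ge0 s n n (act x).
case EK : (normMN s n n (act x)) => [K||]// K0 _; rewrite lee_fin in K0.
have xK M N : (M <= n)%N -> (N <= n)%N -> (normMN s M N (act x) <= K%:E)%E.
  move=> Mn Nn; rewrite -EK; apply: le_trans (normMN_monoM _ _ Mn) _.
  exact: normMN_mono.
have c0 := normc_ge0 c.
(* The difference c x - c' y is split as (c - c') x + c' (x - y). The bound [d <= 1] gives |c'| <
   |c| + 1, and [d] and [r] make each part smaller than [e / 2]. *)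
pose d := Num.min 1 (e / 2 / (K + 1)); pose r := e / 2 / (normc c + 1).
have d0 : 0 < d by rewrite lt_min ltr01/= !divr_gt0// ltr_wpDl.
have r0 : 0 < r by rewrite !divr_gt0// ltr_wpDl.
pose U := [set c' : R[i] | normc (c - c') < d].
pose W := [set y : E | forall M N, (M <= n)%N -> (N <= n)%N ->
  (normMN s M N (act (isoo_bop x - isoo_bop y)%R) < r%:E)%E].
exists (U, W).
  split; last by apply/nbhs_isoo; exists n, r.
  have : nbhs c (ball (c : R[i]^o) (d%:C)%C).
    by apply: (@nbhsx_ballx R[i] R[i]^o); rewrite ltcR.
  by apply: filterS => c' cc'; rewrite /U/= -lt_normc.
move=> [c' y] /= [cc' xy]; apply: cxA => M N Mn Nn.
rewrite (_ : isoo_bop (c *: x) - isoo_bop (c' *: y) =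
  (c - c') *: isoo_bop x + c' *: (isoo_bop x - isoo_bop y)); last first.
  rewrite [isoo_bop (c *: x)](_ : _ = c *: isoo_bop x)//.
  rewrite [isoo_bop (c' *: y)](_ : _ = c' *: isoo_bop y)//.
  by rewrite scalerBl scalerBr addrA subrK.
rewrite actD; apply: le_lt_trans (normMND _ _ _ _ _) _.
rewrite [e in (_ < e%:E)%E]splitr EFinD; apply: lteD.
- apply: le_lt_trans (normMNZ _ _ _ _ _) _.
  apply: le_lt_trans (lee_wpmul2l _ (xK _ _ Mn Nn)) _; rewrite ?lee_fin ?normc_ge0//.
  have d1 : d <= e / 2 / (K + 1) by rewrite ge_min lexx orbT.
  have K1 : 0 < K + 1 by rewrite ltr_wpDl.
  rewrite -EFinM lte_fin; move: cc' d1; rewrite /U/= ler_pdivlMr// => cc' d1.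
  have := normc_ge0 (c - c'); nra.
- apply: le_lt_trans (normMNZ _ _ _ _ _) _.
  apply: le_lt_trans (lee_wpmul2l _ (ltW (xy _ _ Mn Nn))) _; rewrite ?lee_fin ?normc_ge0//.
  have d1 : d <= 1 by rewrite ge_min lexx.
  have c1 : 0 < normc c + 1 by rewrite ltr_wpDl.
  have c'c : normc c' < normc c + 1.
    have := normcD c (- (c - c')); rewrite opprB addrC subrK normcB.
    by move: cc'; rewrite /U/=; lra.
  have rE : r * (normc c + 1) = e / 2 by rewrite divfK// gt_eqF.
  by rewrite -EFinM lte_fin -rE mulrC ltr_pM2l.
Qed.

Lemma bsum_cst M (c : R) : 0 <= c -> bsum M (fun=> c%:E) = (2 ^+ M * c)%:E.
Proof.
move=> c0; elim: M => [|M IHM].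
  by rewrite /bsum big_ord_recl big_ord0 adde0 bin0 mul1e expr0 mul1r.
by rewrite bsumS// IHM -EFinD exprS; congr EFin; ring.
Qed.

Lemma normMN00 a : normMN s 0 0 (act a) = opnorm setT (act a).
Proof.
rewrite opnorm_ent normMN_mx /bsum big_ord_recl big_ord0 adde0 bin0 mul1e.
by apply: eq_mxnorm => k l; rewrite /weightmx /derivmx !expr0 mul1r mulr1.
Qed.

(** Completeness of B(H): the limit is formed coordinate by coordinate, and lower semicontinuity
    bounds it by [e 0] plus the norm of the first term. *)
Lemma bop_limit (B : nat -> bop R) (e : nat -> R) :
  e n @[n --> \oo] --> (0 : R) ->
  (forall p q, (p <= q)%N -> (opnorm setT (act (B q - B p)%R) <= (e p)%:E)%E) ->
  exists a, forall k l, ccvg (fun p => ent (B p) k l) (ent a k l).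
Proof.
move=> e0 BB.
have Bx p q (x : ell2 R) : (p <= q)%N ->
    (l2norm (act (B q) x - act (B p) x)%R <= (e p)%:E * l2norm x)%E.
  move=> pq; apply: le_trans (bop_le (B q - B p) x) _.
  by apply: lee_wpmul2r; [exact: l2norm_ge0|exact: BB].
have /choice[T TP] : forall xk : ell2 R * int, exists z,
    ccvg (fun p => act (B p) xk.1 xk.2) z.
  move=> [x k] /=; have := ell2_fin x; case Ex : (l2norm x) => [r||]// _.
  apply: (@ccvg_cauchy _ _ (fun p => e p * r)).
    by rewrite -(mul0r r); apply: cvgM => //; exact: cvg_cst.
  move=> p q pq; rewrite -lee_fin EFinM -Ex; apply: le_trans (Bx _ _ _ pq).
  exact: (normc_le_l2norm (act (B q) x - act (B p) x)).
pose T' (x : ell2 R) k := T (x, k).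
have T'P (x : ell2 R) k : ccvg (fun p => act (B p) x k) (T' x k) by exact: (TP (x, k)).
have Tlin : lin T'.
  move=> c x x'; apply/funext => k; apply: ccvg_uniq (T'P _ _) _.
  rewrite (_ : (fun p => _) = (fun p => c * act (B p) x k + act (B p) x' k)).
    by apply: ccvgD => //; exact: ccvgM.
  by apply/funext => p; rewrite bop_lin.
have [c c0 cB] := bop_fin (B 0%N).
have e00 : 0 <= e 0%N.
  by rewrite -lee_fin; apply: le_trans (BB 0%N 0%N (leqnn _)); exact: opnorm_ge0.
have [a aT] : exists a, act a = T'.
  apply: (@mk_bop _ _ (e 0%N + c)) => //; first by rewrite addr_ge0.
  apply: opnorm_le => x _ x1.
  apply: (@l2norm_lim _ (fun p => act (B p) x) _ _ 0%N) => // p _.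
  rewrite (_ : act (B p) x =
    (act (B p) x - act (B 0%N) x) + act (B 0%N) x); last by rewrite subrK.
  apply: le_trans (l2normD _ _) _; rewrite EFinD; apply: leeD.
    apply: le_trans (Bx _ _ _ (leq0n p)) _; rewrite -[leRHS]mule1.
    by apply: lee_wpmul2l; rewrite ?lee_fin.
  by rewrite -cB; exact: opnorm_ub.
by exists a => k l; rewrite /ent aT; exact: T'P.
Qed.

(** Each of the M + 1 terms is bounded by the whole norm and passes to the limit separately. Adding
    the bounds gives 2^M, harmless since M is fixed while c tends to 0. *)
Lemma normMN_limit (B : nat -> bop R) a b (c : R) M N P :
  (forall k l, ccvg (fun p => ent (B p) k l) (ent a k l)) ->
  (forall p, (P <= p)%N -> (normMN s M N (act (B p - b)%R) <= c%:E)%E) ->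
  (normMN s M N (act (a - b)%R) <= (2 ^+ M * c)%:E)%E.
Proof.
move=> Ba Bc.
have c0 : 0 <= c by rewrite -lee_fin (le_trans _ (Bc P (leqnn _)))// normMN_ge0.
rewrite normMN_mx -bsum_cst//; apply: le_bsum => j jM.
apply: (@mxnorm_lim _ (fun p => weightmx s N (derivmx s j (ent (B p - b)))) _ _ P).
  move=> k l; rewrite /weightmx /derivmx; under eq_fun do rewrite mulrC; rewrite mulrC.
  apply: ccvgM; apply: ccvgM.
  have nb : ccvg (fun _ : nat => - ent b k l) (- ent b k l).
    by apply: (@ccvg_near _ _ _ 0%N).
  exact: (ccvgD (Ba k l) nb).
by move=> p Pp; exact: (le_trans (normMN_term s N (B p - b) jM) (Bc p Pp)).
Qed.

Lemma isoo_complete (F : set_system E) : ProperFilter F -> cauchy F ->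
  exists l : E, F --> l.
Proof.
move=> PF cF; pose e (p : nat) : R := p.+1%:R^-1.
have e0 p : 0 < e p by rewrite invr_gt0.
have ee p q : (p <= q)%N -> e q <= e p.
  by move=> pq; rewrite lef_pV2 ?posrE ?ltr0n// ler_nat ltnS.
(* The sets [isoo_base (p, e p)] form a countable base of the uniformity, so the Cauchy filter can
   be followed by a sequence. *)
have /choice[x xP] : forall p, exists x : E, F [set y : E | isoo_base (p, e p) (x, y)].
  move=> p; have : isoo_ent (@isoo_base R s (p, e p)) by exists (p, e p) => /=.
  move=> /cF[[U W] /= [FU FW] UW].
  have [x [Ux Wx]] := filter_ex (filterI FU FW).
  by exists x; apply: filterS FW => y Wy; exact: (UW (x, y)).
(* The two points are compared through a third one, common to their two neighbourhoods in the
   filter. *)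
have xx p q : (p <= q)%N -> forall M N, (M <= p)%N -> (N <= p)%N ->
    (normMN s M N (act (isoo_bop (x q) - isoo_bop (x p))%R) <= (2 * e p)%:E)%E.
  move=> pq M N Mp Np.
  have [y [yp yq]] := filter_ex (filterI (xP p) (xP q)).
  rewrite (_ : _ - _ = (isoo_bop (x q) - isoo_bop y) -
    (isoo_bop (x p) - isoo_bop y)); last first.
    by rewrite opprB addrA subrK.
  rewrite actD actN; apply: le_trans (normMND _ _ _ _ _) _; rewrite normMNN.
  rewrite mulr_natl mulr2n EFinD; apply: leeD; last exact/ltW/yp.
  apply: le_trans (ltW (yq M N _ _)) _ => /=; rewrite ?lee_fin ?ee//.
    exact: leq_trans Mp pq.
  exact: leq_trans Np pq.
have [a aP] : exists a, forall k l, ccvg (fun p => ent (isoo_bop (x p)) k l) (ent a k l).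
  apply: (@bop_limit (fun p => isoo_bop (x p)) (fun p => 2 * e p)).
    by rewrite -(mulr0 2); apply: cvgM; [exact: cvg_cst|exact: cvg_harmonic].
  by move=> p q pq; rewrite -normMN00; exact: xx.
have ax p M N : (M <= p)%N -> (N <= p)%N ->
    (normMN s M N (act (a - isoo_bop (x p))%R) <= (2 ^+ M * (2 * e p))%:E)%E.
  by move=> Mp Np; apply: (normMN_limit (P := p) aP) => q pq; exact: xx.
have aI : Isoo_pred s a.
  apply: Is_pred_norms_Isoo => //.
    move=> r r0; have r20 : 0 < r / 2 by rewrite divr_gt0.
    have [p pP] := inv_succ_lt 2 r20; exists (isoo_bop (x p)).
      exact/asboolP/isooP.
    rewrite -normMN00; apply: le_lt_trans (ax p 0%N 0%N _ _) _ => //.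
    by rewrite expr0 mul1r lte_fin; have := pP p (leqnn p); rewrite -/(e p); lra.
  move=> M N; pose p := maxn M N.
  rewrite (_ : a = (a - isoo_bop (x p)) + isoo_bop (x p)); last by rewrite subrK.
  rewrite actD; apply: le_lt_trans (normMND _ _ _ _ _) _.
  apply: lte_add_pinfty; last exact: isoo_norm_fin.
  by apply: le_lt_trans (ax p M N _ _) (ltry _); rewrite ?leq_maxl ?leq_maxr.
exists (IsooOf (introT (asboolP _) aI)) => A /nbhs_isoo[n [r r0 nA]].
have r20 : 0 < r / 2 by rewrite divr_gt0.
(* The summand [2 ^+ n * 2] pays for the distance from [a] to [x p] in all norms with M <= n, the
   summand 1 for that from [x p] to [y]. *)
have [q qP] := inv_succ_lt (2 ^+ n * 2 + 1) r20; pose p := maxn n q.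
have pr : (2 ^+ n * 2 + 1) * e p <= r / 2 by exact: qP (leq_maxr _ _).
apply: filterS (xP p) => y yp; apply: nA => M N Mn Nn /=.
rewrite (_ : a - _ = (a - isoo_bop (x p)) + (isoo_bop (x p) - isoo_bop y)); last first.
  by rewrite addrA subrK.
rewrite actD; apply: le_lt_trans (normMND _ _ _ _ _) _.
have Mp : (M <= p)%N by rewrite (leq_trans Mn)// leq_maxl.
have Np : (N <= p)%N by rewrite (leq_trans Nn)// leq_maxl.
apply: le_lt_trans (leeD (ax p M N Mp Np) (ltW (yp M N Mp Np))) _ => /=.
rewrite -EFinD lte_fin.
have : 2 ^+ M <= 2 ^+ n :> R by rewrite ler_weXn2l// ler1n.
have := e0 p; nra.
Qed.

End Topology.

Theorem proposition3p2 (R : realType) (s : nat) (hs : (2 <= s)%N) (a b : bop R) :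
  (* 1 *)
  (Isoo_pred s a <->
     Is_pred s a /\ forall M N : nat, (normMN s M N (act a) < +oo)%E) /\
  (* 2 *)
  (forall M N : nat,
     normMN s M.+1 N (act a) =
     (normMN s M N (act a) + normMN s M N (delta s (act a)))%E) /\
  (* 3 *)
  (forall M N : nat, (normMN s M N (act a) <= normMN s M N.+1 (act a))%E) /\
  (* 4 *)
  (forall M N : nat,
     (normMN s M N (act (bmul a b)) <=
        normMN s M 0 (act a) * normMN s M N (act b))%E /\
     (normMN s M 0 (act a) * normMN s M N (act b) <=
        normMN s M N (act a) * normMN s M N (act b))%E) /\
  (* 5 *)
  (forall M N : nat,
     (normMN s M N (delta s (act a)) <= normMN s M.+1 N (act a))%E) /\
  (* 6 *)
  (forall astar : bop R, is_adjoint a astar ->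
     forall M N : nat,
       (normMN s M N (act astar) <= normMN s (M + N) N (act a))%E) /\
  (* 7 *)
  (continuous (fun z : Isoo R s * Isoo R s => z.1 + z.2) /\
   continuous (fun z : R[i] * Isoo R s => z.1 *: z.2) /\
   (forall F : set_system (Isoo R s),
      ProperFilter F -> cauchy F -> exists l : Isoo R s, F --> l)).
Proof.
split; [split|split; [|split; [|split; [|split; [|split]]]]].
- move=> aI; split; [exact: Isoo_pred_Is|exact: Isoo_pred_norms].
- by move=> [aI afin]; exact: Is_pred_norms_Isoo.
- by move=> M N; exact: normMN_S.
- by move=> M N; exact: normMN_mono.
- move=> M N; split; first exact: normMN_bmul.
  by apply: lee_wpmul2r; [exact: normMN_ge0|exact: normMN_mono].
- by move=> M N; rewrite normMN_S leeDr// normMN_ge0.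
- by move=> astar ad M N; exact: normMN_adj.
- split; first exact: isoo_add_continuous.
  by split; [exact: isoo_scale_continuous|exact: isoo_complete].
Qed.
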